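(* Consider the infinite Poisson model with parameters $\lambda>0$, $K>0$, $\beta>2$ and shadowing variable $S>0$ with $\mathbf{E}[S^{2/\beta}]<\infty$, with path-loss factor $L$ and interference factor $f$. Then for every $z\ge 0$ and (almost every) $s>0$, the Laplace transform of the interference factor conditional on the path-loss factor is $$\mathbf{E}\left[e^{-zf}\mid L=s\right]=e^{-a\left[\varphi_\beta(z)-1\right]s^{2/\beta}},$$ where $$a=\frac{\lambda\pi\,\mathbf{E}[S^{2/\beta}]}{K^2},\qquad \varphi_\beta(z)=e^{-z}+z^{2/\beta}\,\gamma\left(1-\frac{2}{\beta},z\right).$$
   Context: Infinite Poisson model: $\Phi=\{X_i\}_{i\in\mathbb{N}}$ is a homogeneous Poisson point process of intensity $\lambda$ on $\mathbb{R}^2$; $(S_i)_{i\in\mathbb{N}}$ are i.i.d. positive random variables, independent of $\Phi$, with the same distribution as $S$. The propagation losses are $L_{X_i}=\frac{(K|X_i|)^\beta}{S_i}$. The path-loss factor is $L=\inf_{i\in\mathbb{N}}L_{X_i}$ and the interference factor is $f=L\sum_{i\in\mathbb{N}}\frac{1}{L_{X_i}}-1$. The lower incomplete gamma function is $\gamma(\alpha,z)=\int_0^z t^{\alpha-1}e^{-t}\,dt$. *)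

(* Defs.v *)
From HB Require Import structures.
From mathcomp Require Export all_boot all_order all_algebra finmap.
From mathcomp Require Export all_classical all_reals all_analysis.
From mathcomp Require Export measurable_realfun random_variable.
Export Order.TTheory GRing.Theory Num.Theory.
Export numFieldNormedType.Exports.

Set Implicit Arguments.
Unset Strict Implicit.
Unset Printing Implicit Defensive.

Local Open Scope classical_set_scope.
Local Open Scope ring_scope.
Local Open Scope ereal_scope.

Section Independence.
Context {d d' d'' : measure_display} {T : measurableType d}
  {T1 : measurableType d'} {T2 : measurableType d''} {R : realType}.
Variable P : probability T R.

Definition mutually_independent (I : choiceType) (X : I -> T -> T1) : Prop :=
  forall (J : {fset I}) (B : I -> set T1), (forall i, measurable (B i)) ->
    P (\bigcap_(i in [set` J]) (X i @^-1` B i)) =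
    \prod_(i <- J) P (X i @^-1` B i).

Definition sigma_family (dE : measure_display) (E : measurableType dE)
    (I : Type) (X : I -> T -> E) : set (set T) :=
  <<s \bigcup_i preimage_set_system setT (X i) measurable >>.

Definition independent_families (I J : Type)
    (X : I -> T -> T1) (Y : J -> T -> T2) : Prop :=
  forall A B : set T, sigma_family X A -> sigma_family Y B ->
    P (A `&` B) = P A * P B.

End Independence.

Section CondExpectation.
Context {d d' : measure_display} {T : measurableType d}
  {T' : measurableType d'} {R : realType}.

(* g is a version of s |-> E[Y | X = s]; [pushforward P X] is the law of X. *)
Definition is_cond_expectation (P : probability T R) (X : T -> T')
    (Y : T -> \bar R) (g : T' -> \bar R) : Prop :=
  (pushforward P X).-integrable [set: T'] g /\
  (forall B : set T', measurable B ->
     \int[P]_(w in X @^-1` B) Y w = \int[pushforward P X]_(s in B) g s).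

End CondExpectation.

Section PoissonProcess.
Context {d : measure_display} {T : measurableType d} {R : realType}.
Variable P : probability T R.

Definition lebesgue_plane : set (R * R) -> \bar R :=
  lebesgue_measure \x lebesgue_measure.

Definition count_points (X : nat -> T -> R * R) (A : set (R * R)) (w : T)
    : \bar R :=
  \sum_(i <oo) (\1_A (X i w))%:E.

(* Not the library's poisson_pmf, which is constantly 1 at rate 0: Lebesgue-null
   sets must contain no point almost surely, i.e. have pmf 0 ^+ k / k`!. *)
Definition poisson_weight (r : R) (k : nat) : R :=
  (r ^+ k / k`!%:R * expR (- r))%R.

Definition homogeneous_poisson_process (lambda : R) (X : nat -> T -> R * R)
    : Prop :=
  forall (n : nat) (A : 'I_n -> set (R * R)) (k : 'I_n -> nat),
    (forall j, measurable (A j)) ->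
    (forall j, lebesgue_plane (A j) < +oo) ->
    trivIset setT A ->
    P [set w | forall j, count_points X (A j) w = ((k j)%:R)%:E] =
    (\prod_(j < n) poisson_weight (lambda * fine (lebesgue_plane (A j))) (k j))%:E.

End PoissonProcess.

Section Network.
Context {d : measure_display} {T : measurableType d} {R : realType}.
Variables (K beta : R) (X : nat -> T -> R * R) (S : nat -> T -> R).

(* The library's norm on a product is the sup norm. *)
Definition euclidean_norm (x : R * R) : R := Num.sqrt (x.1 ^+ 2 + x.2 ^+ 2).

Definition propagation_loss (i : nat) (w : T) : R :=
  ((K * euclidean_norm (X i w)) `^ beta / S i w)%R.

Definition path_loss_factor (w : T) : R :=
  inf (range (fun i => propagation_loss i w)).

(* Extended-real valued: the series is finite only almost surely. *)
Definition interference_factor (w : T) : \bar R :=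
  (path_loss_factor w)%:E * (\sum_(i <oo) ((propagation_loss i w)%:E)^-1) - 1.

End Network.

Section SpecialFunctions.
Context {R : realType}.
Local Open Scope ring_scope.

Definition lower_incomplete_gamma (alpha z : R) : R :=
  \int[lebesgue_measure]_(t in `[0, z]) (t `^ (alpha - 1) * expR (- t)).

Definition varphi (beta z : R) : R :=
  expR (- z) + z `^ (2 / beta) * lower_incomplete_gamma (1 - 2 / beta) z.

End SpecialFunctions.

(* Main.v *)
From HB Require Import structures.
Require Import Defs.
From mathcomp Require Import ring lra.

(* Let N be the point process of the losses on the half-line. The marks being
   independent of the points, the expectation of a product of weights
   r(X_i, S_i) is that of the product of the averaged weights
   p(x) = E[r(x, S)], and the Laplace functional of the Poisson process gives
   exp (- lambda * int (1 - p)). Weights that vanish on losses below s and are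
   exp (- u / t) at a loss t >= s yield
     E[exp (- u * sum_i 1 / L_i); L >= s] = exp (- a varphi(u / s) s^(2/beta)),
   where writing 1 - exp (- u / t) as an integral of exp (- tau) over
   tau < u / t reduces the integral over the plane to areas of discs.
   This is only the joint law of L and sum_i 1 / L_i in transformed form; the
   conditional expectation is extracted by comparing increments in s. On
   {s <= L < s'} the variable exp (- z f) lies between
   exp z * exp (- z s' sum_i 1 / L_i) and exp z * exp (- z s sum_i 1 / L_i), so
   that the increments of F s = E[exp (- z f); L >= s], and those of
   H s = E[g(L); L >= s] with g the claimed formula, satisfy the same bounds,
   which are tight at first order. Hence F - H has derivative 0; it vanishes at
   infinity, so F = H, and the half-lines generate the Borel sets. *)

Set Implicit Arguments.
Unset Strict Implicit.
Unset Printing Implicit Defensive.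

Local Open Scope classical_set_scope.
Local Open Scope ring_scope.

(** * Laws weighted by a density and independent marks *)

(** The enumeration [X i] is arbitrary: nothing is given about the law of a single point, only about
    counts, and the marks are independent of the family of points as a whole. Hence the identities
    are proved for products over [i < m], marks being averaged one at a time, and passed to the
    limit. Write I = sum_i 1 / L_i. The tail identity treats exp (- u I) for a fixed u, whereas exp
    (- z f) = exp z * exp (- z L I) has the random multiplier z L. The first-order behaviour on a
    band s <= L < s' is explicit because, at fixed u, raising the cutoff from s to s' only removes
    the weights exp (- u / t) of the losses t in between: varphi(u / s) s^(2/beta) grows by about
    exp (- u / s) times the increment of s^(2/beta). At u = z s this factor is exp (- z) and cancels
    exp z. With x = a s^(2/beta), the band thus contributes exp (- varphi(z) x) dx to the
    expectation of exp (- z f), while its probability is exp (- x) dx; the quotient is the claimed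
    formula. *)

Section density.
Local Open Scope ereal_scope.
Context d (T : measurableType d) (R : realType).
Variables (mu : {measure set T -> \bar R}) (f : T -> R).

Definition density (mf : measurable_fun setT f) (f0 : forall x, (0 <= f x)%R) :=
  fun A : set T => \int[mu]_(x in A) (f x)%:E.

Hypotheses (mf : measurable_fun setT f) (f0 : forall x, (0 <= f x)%R).

Let density0 : density mf f0 set0 = 0.
Proof. exact: integral_set0. Qed.

Let density_ge0 A : 0 <= density mf f0 A.
Proof. by apply: integral_ge0 => x _; rewrite lee_fin. Qed.

Let density_sigma_additive : semi_sigma_additive (density mf f0).
Proof.
apply: semi_sigma_additive_nng_induced; first exact/measurable_EFinP.
by move=> x; rewrite lee_fin.
Qed.

HB.instance Definition _ := isMeasure.Build _ _ _ (density mf f0)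
  density0 density_ge0 density_sigma_additive.

Import HBNNSimple.

(** Monotone convergence along simple approximations reduces the change of density to indicators of
    level sets. *)
Lemma ge0_integral_density (g : T -> \bar R) :
  measurable_fun setT g -> (forall x, 0 <= g x) ->
  \int[density mf f0]_x g x = \int[mu]_x (g x * (f x)%:E).
Proof.
move=> mg g0; pose h := nnsfun_approx measurableT mg.
have mfE : measurable_fun setT (EFin \o f) by exact/measurable_EFinP.
have hg x : (h n x)%:E @[n --> \oo] --> g x by exact: cvg_nnsfun_approx.
transitivity (limn (fun n => \int[density mf f0]_x (h n x)%:E)).
  rewrite -monotone_convergence//.
  - by apply: eq_integral => x _; exact/esym/cvg_lim.
  - by move=> n; exact/measurable_EFinP/measurable_funP.
  - by move=> n x _; rewrite lee_fin.
  - by move=> x _ m n mn; rewrite lee_fin; exact/lefP/nd_nnsfun_approx.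
transitivity (limn (fun n => \int[mu]_x ((h n x)%:E * (f x)%:E))); last first.
  rewrite -monotone_convergence//.
  - by apply: eq_integral => x _; apply/cvg_lim => //; apply: cvgeZr.
  - by move=> n; apply: emeasurable_funM => //; exact/measurable_EFinP.
  - by move=> n x _; rewrite mule_ge0// lee_fin.
  - move=> x _ m n mn; apply: lee_wpmul2r; first by rewrite lee_fin.
    by rewrite lee_fin; exact/lefP/nd_nnsfun_approx.
congr (limn _); apply/funext => n.
transitivity (\int[density mf f0]_x (\sum_(y \in range (h n))
    (y * \1_(h n @^-1` [set y]) x)%:E)).
  by apply: eq_integral => x _; rewrite fsumEFin// -(fimfunE _ x).
rewrite ge0_integral_fsum//; last 2 first.
- by move=> y; exact/measurable_EFinP/measurable_funM.
- by move=> y x _; rewrite nnfun_muleindic_ge0.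
transitivity (\int[mu]_x (\sum_(y \in range (h n))
    (y * \1_(h n @^-1` [set y]) x)%:E * (f x)%:E)); last first.
  apply: eq_integral => x _.
  rewrite -ge0_mule_fsuml => [|y]; last exact: nnfun_muleindic_ge0.
  by rewrite fsumEFin// -(fimfunE _ x).
rewrite ge0_integral_fsum//; last 2 first.
- move=> y; apply: emeasurable_funM => //.
  by apply/measurable_EFinP; exact: measurable_funM.
- by move=> y x _; rewrite mule_ge0// ?lee_fin// -lee_fin nnfun_muleindic_ge0.
apply: eq_fsbigr => r rh.
have r0 : (0 <= r)%R by move: rh; rewrite inE => -[x _ <-].
under eq_integral do rewrite EFinM.
rewrite integralZl_indic_nnsfun//.
under [RHS]eq_integral do rewrite EFinM -muleA.
rewrite ge0_integralZl//.
- rewrite integral_indic// setIT; congr (_ * _).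
  rewrite -[LHS]/(\int[mu]_(x in h n @^-1` [set r]) (f x)%:E) [LHS]integral_mkcond.
  apply: eq_integral => x _.
  by rewrite patchE indicE; case: ifPn => xA; rewrite ?mul1e ?mul0e.
- by apply: emeasurable_funM => //; exact/measurable_EFinP.
- by move=> x _; rewrite mule_ge0// lee_fin.
Qed.

End density.

Section weighted_law.
Local Open Scope ereal_scope.
Context d (T : measurableType d) d' (E : measurableType d') (R : realType).
Variables (P : probability T R) (Z : T -> E) (V : T -> R) (M : R).

(** The law of [Z] under the measure of density [V] with respect to [P]; the bound [M] makes it a
    finite measure. *)
Definition weighted_law (mZ : measurable_fun setT Z) (mV : measurable_fun setT V)
    (VM : forall w, (0 <= V w <= M)%R) :=
  fun C : set E => \int[P]_(w in Z @^-1` C) (V w)%:E.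

Hypotheses (mZ : measurable_fun setT Z) (mV : measurable_fun setT V)
  (VM : forall w, (0 <= V w <= M)%R).

Let V0 w : (0 <= V w)%R. Proof. by have /andP[] := VM w. Qed.

(** The same set function is the pushforward of the density measure along [Z], so that the measure
    axioms are inherited by conversion. *)
Let law := measure_function_pushforward__canonical__measure_function_Measure
  (density P mV V0) mZ.

Let weighted_law0 : weighted_law mZ mV VM set0 = 0.
Proof. exact: (@measure0 _ _ _ law). Qed.

Let weighted_law_ge0 C : 0 <= weighted_law mZ mV VM C.
Proof. exact: (@measure_ge0 _ _ _ law). Qed.

Let weighted_law_sigma_additive : semi_sigma_additive (weighted_law mZ mV VM).
Proof. exact: (@measure_semi_sigma_additive _ _ _ law). Qed.

HB.instance Definition _ := isMeasure.Build _ _ _ (weighted_law mZ mV VM)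
  weighted_law0 weighted_law_ge0 weighted_law_sigma_additive.

Lemma weighted_law_fin : fin_num_fun (weighted_law mZ mV VM).
Proof.
move=> C mC; rewrite ge0_fin_numE//.
have mZC : measurable (Z @^-1` C) by rewrite -[X in measurable X]setTI; exact: mZ.
have M0 : (0 <= M)%R by have /andP[] := VM point; exact: le_trans.
apply: (@le_lt_trans _ _ (\int[P]_(w in Z @^-1` C) M%:E)).
  apply: ge0_le_integral => //.
  - by move=> w _; rewrite lee_fin.
  - by apply/measurable_EFinP; exact: measurable_funTS.
  - by move=> w _; rewrite lee_fin; have /andP[] := VM w.
rewrite integral_cst//; apply: (@le_lt_trans _ _ (M%:E * 1)).
  by apply: lee_wpmul2l; rewrite ?lee_fin//; exact: probability_le1.
by rewrite mule1 ltry.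
Qed.

HB.instance Definition _ := Measure_isFinite.Build _ _ _ (weighted_law mZ mV VM)
  weighted_law_fin.

Lemma ge0_integral_weighted_law (g : E -> \bar R) :
  measurable_fun setT g -> (forall x, 0 <= g x) ->
  \int[weighted_law mZ mV VM]_x g x = \int[P]_w (g (Z w) * (V w)%:E).
Proof.
move=> mg g0.
rewrite -[LHS]/(\int[pushforward (density P mV V0) Z]_x g x).
rewrite ge0_integral_pushforward// preimage_setT ge0_integral_density//.
  exact: measurableT_comp.
by move=> w; exact: g0.
Qed.

End weighted_law.

(** * Averaging over independent marks *)

Section marking.
Local Open Scope ereal_scope.
Context d (T : measurableType d) (R : realType) (P : probability T R).
Context d1 (E : measurableType d1) d2 (F : measurableType d2).
Variables (X : nat -> {RV P >-> E}) (S : nat -> {RV P >-> F}).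
Variable m : probability F R.
Hypothesis lawS : forall i B, measurable B -> P (S i @^-1` B) = m B.
Hypothesis indS : mutually_independent P S.
Hypothesis indXS : independent_families P X S.

Variables (r : nat -> E * F -> R) (p : nat -> E -> R).
Hypothesis mr : forall i, measurable_fun setT (r i).
Hypothesis r01 : forall i y, (0 <= r i y <= 1)%R.
Hypothesis mp : forall i, measurable_fun setT (p i).
Hypothesis p01 : forall i x, (0 <= p i x <= 1)%R.
Hypothesis pE : forall i x, \int[m]_s (r i (x, s))%:E = (p i x)%:E.

Let capS (J : {fset nat}) (B : nat -> set F) :=
  \bigcap_(i in [set` J]) S i @^-1` B i.

Let mXi i C : measurable C -> measurable (X i @^-1` C).
Proof. by move=> mC; rewrite -[X in measurable X]setTI; exact: measurable_funP. Qed.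

Let mSi i C : measurable C -> measurable (S i @^-1` C).
Proof. by move=> mC; rewrite -[X in measurable X]setTI; exact: measurable_funP. Qed.

Let mcapS J B : (forall i, measurable (B i)) -> measurable (capS J B).
Proof. by move=> mB; apply: fin_bigcap_measurable => // i _; exact: mSi. Qed.

Let msigX A : sigma_family (fun i => X i) A -> measurable A.
Proof.
apply: smallest_sub; first exact: sigma_algebra_measurable.
by move=> C [i _ [B mB <-]]; rewrite setTI; exact: mXi.
Qed.

Let sigS J B : (forall i, measurable (B i)) ->
  sigma_family (fun i => S i) (capS J B).
Proof.
move=> mB; rewrite /sigma_family.
pose G := \bigcup_i preimage_set_system setT (S i) measurable.
apply: (@fin_bigcap_measurable _ (g_sigma_algebraType G) _ [set` J]
  (fun i => S i @^-1` B i)) => // i _; apply: sub_sigma_algebra.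
by exists i => //; exists (B i); rewrite ?setTI.
Qed.

(** The events on the points and on the marks of index at least [n] strengthen the induction on [n].
    Fed with the rectangles {[X n] in C, [S n] in D}, the induction hypothesis says that, under the
    weight of the first [n] factors, [S n] is independent of [X n] and has law [m]; Fubini then
    replaces [r n] by its average [p n]. *)
Lemma marking_rect n (A : set T) (J : {fset nat}) (B : nat -> set F) :
  sigma_family (fun i => X i) A -> (forall i, measurable (B i)) ->
  (forall i, i \in J -> (n <= i)%N) ->
  \int[P]_(w in A `&` capS J B) (\prod_(i < n) r i (X i w, S i w))%:E =
  (\int[P]_(w in A) (\prod_(i < n) p i (X i w))%:E) * P (capS J B).
Proof.
elim: n A J B => [|n IH] A J B sA mB Jn.
  under eq_integral do rewrite big_ord0.
  under [in RHS]eq_integral do rewrite big_ord0.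
  have mA := msigX sA; have mJ := mcapS J mB.
  rewrite !integral_cst//; last exact: measurableI.
  by rewrite !mul1e; apply: indXS => //; exact: sigS.
have mA := msigX sA; have mJ := mcapS J mB.
have mAJ : measurable (A `&` capS J B) by exact: measurableI.
have mrX i : measurable_fun setT (fun w => r i (X i w, S i w)).
  apply: measurableT_comp => //.
  by apply: measurable_fun_pair; exact: measurable_funP.
have mpX i : measurable_fun setT (fun w => p i (X i w)).
  by apply: measurableT_comp => //; exact: measurable_funP.
(* [V] is the weight before averaging the first [n] marks and [V'] the one after, in which the marks
   of [J] survive only through their probability. *)
pose V w := (\prod_(i < n) r i (X i w, S i w) * \1_(A `&` capS J B) w)%R.
pose V' w := (\prod_(i < n) p i (X i w) * \1_A w * fine (P (capS J B)))%R.
have prod01 k (u : nat -> R) : (forall i, 0 <= u i <= 1)%R ->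
    (0 <= \prod_(i < k) u i <= 1)%R.
  move=> u01; apply/andP; split; last by apply: prodr_ile1 => i _; exact: u01.
  by apply: prodr_ge0 => i _; case/andP: (u01 i).
have V01 w : (0 <= V w <= 1)%R.
  have /andP[a0 a1] := prod01 n (fun i => r i (X i w, S i w)) (fun i => r01 _ _).
  by rewrite /V indicE mulr_ge0//= mulr_ile1// lern1; case: (_ \in _).
have V'01 w : (0 <= V' w <= 1)%R.
  have /andP[a0 a1] := prod01 n (fun i => p i (X i w)) (fun i => p01 _ _).
  have P0 : (0 <= fine (P (capS J B)))%R by exact: fine_ge0.
  have P1 : (fine (P (capS J B)) <= 1)%R.
    by rewrite -lee_fin fineK ?fin_num_measure// probability_le1.
  have I1 : (\1_A w <= 1 :> R)%R by rewrite indicE lern1; case: (_ \in _).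
  rewrite /V' !mulr_ge0//=; apply: mulr_ile1 => //; first exact: mulr_ge0.
  exact: mulr_ile1.
have mV : measurable_fun setT V.
  by apply: measurable_funM; [exact: measurable_prod|exact: measurable_indic].
have mV' : measurable_fun setT V'.
  apply: measurable_funM => //.
  by apply: measurable_funM; [exact: measurable_prod|exact: measurable_indic].
have mXS : measurable_fun setT (fun w => (X n w, S n w)).
  by apply: measurable_fun_pair; exact: measurable_funP.
pose mu1 := weighted_law P mXS mV V01.
pose nu1 := weighted_law P (measurable_funP (X n)) mV' V'01.
(* A product measure is determined by rectangles; there the induction hypothesis applies with [X n]
   in C added to [A] and the new index [n], which is outside [J], added to [J]. *)
have eqmu Y : measurable Y -> (nu1 \x m) Y = mu1 Y.
  apply: product_measure_unique => {Y} C D mC mD.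
  pose B' i := if i == n then D else B i.
  have nJ : n \notin J by apply/negP => /Jn; rewrite ltnn.
  have mB' i : measurable (B' i) by rewrite /B'; case: ifP.
  have capB' : capS (n |` J)%fset B' = capS J B `&` S n @^-1` D.
    rewrite /capS; apply/seteqP; split => [w wc|w [wc wD] i /=].
      split => [i /= iJ|].
        have := wc i; rewrite /= in_fset1U iJ orbT => /(_ isT).
        by rewrite /B'; case: eqVneq => // ein; rewrite -ein iJ in nJ.
      by have := wc n; rewrite /= in_fset1U eqxx => /(_ isT); rewrite /B' eqxx.
    rewrite in_fset1U /B'; case: eqVneq => [->//|_ /= iJ]; exact: wc.
  have sAC : sigma_family (fun i => X i) (A `&` X n @^-1` C).
    pose G := \bigcup_i preimage_set_system setT (X i) measurable.
    apply: (@measurableI _ (g_sigma_algebraType G)) => //.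
    apply: sub_sigma_algebra.
    by exists n => //; exists C; rewrite ?setTI.
  have := IH _ (n |` J)%fset B' sAC mB'; rewrite capB'.
  have -> : P (capS J B `&` S n @^-1` D) = P (capS J B) * m D.
    rewrite -capB' indS// big_fsetU1//= [X in P X](_ : _ = S n @^-1` D).
      rewrite lawS// muleC; congr (_ * _).
      rewrite indS//; apply: eq_big_seq => i iJ; rewrite /B'.
      by case: eqVneq => // ein; rewrite -ein iJ in nJ.
    by rewrite /B' eqxx.
  move=> IHn.
  have fpos w : (0 <= \prod_(i < n) p i (X i w))%R.
    by rewrite prodr_ge0// => i _; case/andP: (p01 i (X i w)).
  have nu1C : nu1 C =
      (\int[P]_(w in A `&` X n @^-1` C) (\prod_(i < n) p i (X i w))%:E) *
      P (capS J B).
    rewrite /nu1 /= /weighted_law -[P (capS J B)]fineK ?fin_num_measure//.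
    rewrite -ge0_integralZr//; last first.
    - by rewrite lee_fin fine_ge0.
    - by move=> w _; rewrite lee_fin.
    - by apply/measurable_EFinP/measurable_funTS; exact: measurable_prod.
    - by apply: measurableI => //; exact: mXi.
    rewrite [LHS]integral_mkcond [RHS]integral_mkcond; apply: eq_integral => w _.
    rewrite !patchE in_setI /V' indicE.
    by case: (w \in A); case: (w \in _); rewrite //= ?mulr1 -?EFinM// mulr0 mul0r.
  rewrite -[RHS]/(nu1 C * m D) nu1C -muleA -IHn => [|i]; last first.
    by rewrite in_fset1U => /orP[/eqP->//|/Jn/ltnW].
  rewrite /mu1 /= /weighted_law [LHS]integral_mkcond [RHS]integral_mkcond.
  apply: eq_integral => w _; rewrite !patchE /V indicE.
  have -> : (w \in (fun w => (X n w, S n w)) @^-1` (C `*` D)) =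
      (w \in X n @^-1` C) && (w \in S n @^-1` D).
    by apply/idP/andP; rewrite !inE.
  rewrite !in_setI; case: (w \in A); case: (w \in X n @^-1` C);
    case: (w \in capS J B); case: (w \in S n @^-1` D);
    by rewrite //= ?mulr1 ?mulr0.
have mrE : measurable_fun setT (EFin \o r n) by exact/measurable_EFinP.
have rE0 y : 0 <= (EFin \o r n) y by rewrite /= lee_fin; case/andP: (r01 n y).
have mpE : measurable_fun setT (EFin \o p n) by exact/measurable_EFinP.
have pE0 y : 0 <= (EFin \o p n) y by rewrite /= lee_fin; case/andP: (p01 n y).
transitivity (\int[mu1]_y (r n y)%:E).
  rewrite ge0_integral_weighted_law// integral_mkcond; apply: eq_integral => w _.
  rewrite patchE -EFinM /V indicE big_ord_recr/=.
  by case: (w \in _); rewrite ?mulr1 ?mulr0// mulrC.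
transitivity (\int[nu1 \x m]_y (r n y)%:E).
  by apply/esym/eq_measure_integral => Y mY _; exact: eqmu.
rewrite (fubini_tonelli1 (EFin \o r n))//= /fubini_F/=.
under eq_integral do rewrite pE.
rewrite ge0_integral_weighted_law// -[P (capS J B)]fineK ?fin_num_measure//.
rewrite -ge0_integralZr//; last first.
- by rewrite lee_fin fine_ge0.
- move=> w _; rewrite lee_fin.
  by rewrite prodr_ge0// => i _; case/andP: (p01 i (X i w)).
- by apply/measurable_EFinP/measurable_funTS; exact: measurable_prod.
rewrite [RHS]integral_mkcond; apply: eq_integral => w _.
rewrite patchE -EFinM /V' indicE big_ord_recr/=.
case: (w \in _); rewrite ?mulr1 ?mulr0 ?mul0r ?mulr0//.
by rewrite -EFinM mulrA [X in (X * _)%R]mulrC.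
Qed.

Lemma marking n : \int[P]_w (\prod_(i < n) r i (X i w, S i w))%:E =
  \int[P]_w (\prod_(i < n) p i (X i w))%:E.
Proof.
have sT : sigma_family (fun i => X i) setT.
  pose G := \bigcup_i preimage_set_system setT (X i) measurable.
  exact: (@measurableT _ (g_sigma_algebraType G)).
have := @marking_rect n setT fset0 (fun=> setT) sT (fun=> measurableT).
rewrite (_ : capS _ _ = setT) ?setTI ?probability_setT ?mule1; first by apply.
by rewrite /capS set_fset0 bigcap_set0.
Qed.

End marking.

(** * The Laplace functional of a Poisson process *)

Section poisson_series.
Context {R : realType}.

Lemma poisson_weight_ge0 (r : R) k : 0 <= r -> 0 <= poisson_weight r k.
Proof. by move=> r0; rewrite /poisson_weight mulr_ge0 ?expR_ge0// divr_ge0// exprn_ge0. Qed.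

Lemma poisson_generating_function (r c : R) : 0 <= r -> 0 <= c ->
  (\sum_(k <oo) (c ^+ k * poisson_weight r k)%:E = (expR (- (r * (1 - c))))%:E)%E.
Proof.
move=> r0 c0.
have -> : (expR (- (r * (1 - c))))%:E = ((expR (- r))%:E * (expR (c * r))%:E)%E.
  by rewrite -EFinM -expRD; congr (expR _)%:E; ring.
under eq_eseriesr => k _.
  have -> : c ^+ k * poisson_weight r k = expR (- r) * exp_coeff (c * r) k.
    by rewrite /poisson_weight /exp_coeff/= exprMn; ring.
  rewrite EFinM; over.
rewrite nneseriesZl/=; last first.
  by move=> k _; rewrite lee_fin /exp_coeff/= divr_ge0// exprn_ge0// mulr_ge0.
congr *%E.
rewrite -[expR (c * r)]/(limn (series (exp_coeff (c * r)))) -EFin_lim; last first.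
  exact: is_cvg_series_exp_coeff.
by apply/congr_lim/funext => n/=; rewrite /series/= -sumEFin.
Qed.

Lemma nneseries_single (f : nat -> \bar R) l : (forall k, (0 <= f k)%E) ->
  (forall k, k != l -> f k = 0%E) -> (\sum_(k <oo) f k = f l)%E.
Proof.
move=> f0 fl; rewrite (@nneseriesD1 _ _ l xpredT)//.
by rewrite eseries0 ?adde0// => k _; exact: fl.
Qed.

End poisson_series.

Section nnsfun_blocks.
Context d (T : measurableType d) (R : realType).
Import HBNNSimple.

Lemma nnsfun_disjoint_blocks (g : {nnsfun T >-> R}) :
  exists n (v : nat -> R) (A : nat -> set T),
    [/\ forall j, 0 < v j, forall j, measurable (A j), trivIset setT A &
        forall x, g x = \sum_(j < n) v j * \1_(A j) x].
Proof.
pose s := [seq y <- fset_set (range g) | y != 0].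
have us : uniq s by apply: filter_uniq; exact: fset_uniq.
have memg x : g x != 0 -> g x \in s.
  move=> gx; rewrite mem_filter gx/= in_fset_set//.
  by rewrite inE; exists x.
(* The blocks are the level sets of the nonzero values. The default 1 of [nth] keeps [v j] positive
   past the end of [s], where the blocks are empty. *)
exists (size s), (nth 1 s), (fun j => if (j < size s)%N then g @^-1` [set nth 1 s j] else set0).
split.
- move=> j; have [js|js] := ltnP j (size s); last by rewrite nth_default.
  have : nth 1 s j \in s by rewrite mem_nth.
  rewrite mem_filter => /andP[s0]; rewrite in_fset_set// inE => -[x _ gx].
  by rewrite lt_def s0 -gx /=; exact: fun_ge0.
- by move=> j; case: ifP.
- apply/trivIsetP => i j _ _ ij; case: ifP => [ilt|]; last by rewrite set0I.
  case: ifP => [js|]; last by rewrite setI0.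
  apply/seteqP; split => // x [/= gi gj].
  by move: ij; rewrite -(nth_uniq 1 ilt js us) -gi -gj eqxx.
- move=> x; have [gx|gx] := eqVneq (g x) 0.
    rewrite big1 ?gx// => j _; rewrite ltn_ord indicE memNset ?mulr0//= => gj.
    have : nth 1 s j \in s by rewrite mem_nth.
    by rewrite mem_filter -gj gx eqxx.
  have js : (index (g x) s < size s)%N by rewrite index_mem memg.
  rewrite (bigD1 (Ordinal js))//= js indicE mem_set/=; last by rewrite nth_index ?memg.
  rewrite nth_index ?memg// mulr1 big1 ?addr0// => j jj.
  rewrite ltn_ord indicE memNset ?mulr0//= => gj.
  move/eqP: jj; apply; apply: val_inj => /=; rewrite gj index_uniq//.
Qed.

End nnsfun_blocks.

Section cvg_aux.
Context {R : realType}.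

Lemma cvg_nat_eventually_eq (u : nat -> nat) (l : nat) :
  ((u m)%:R%:E @[m --> \oo] --> (l%:R%:E : \bar R))%E -> \forall m \near \oo, u m = l.
Proof.
move=> /fine_cvgP[_ /cvgrPdist_lt/(_ 1 ltr01)] h.
near=> m; have : `|l%:R - (u m)%:R : R| < 1 by near: m; exact: h.
rewrite ltr_norml => /andP[h1 h2].
have [lu|ul|//] := ltngtP l (u m); exfalso.
- have : l.+1%:R <= (u m)%:R :> R by rewrite ler_nat.
  by rewrite -natr1; lra.
- have : (u m).+1%:R <= l%:R :> R by rewrite ler_nat.
  by rewrite -natr1; lra.
Unshelve. all: by end_near. Qed.

Lemma cvg_prod_ord (f : nat -> nat -> R) (a : nat -> R) n :
  (forall j, f j m @[m --> \oo] --> a j) ->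
  \prod_(j < n) f j m @[m --> \oo] --> \prod_(j < n) a j.
Proof.
move=> fa; elim: n => [|n IH].
  by rewrite big_ord0; under eq_cvg do rewrite big_ord0; exact: cvg_cst.
rewrite big_ord_recr; under eq_cvg do rewrite big_ord_recr.
by apply: cvgM.
Qed.

Lemma prod_ord_nonincreasing (u : nat -> R) : (forall i, 0 <= u i <= 1) ->
  {homo (fun m => \prod_(i < m) u i) : m m' / (m <= m')%N >-> m' <= m}.
Proof.
move=> u01; apply/nonincreasing_seqP => m; rewrite big_ord_recr/=.
apply: ler_piMr; last by case/andP: (u01 m).
by apply: prodr_ge0 => i _; case/andP: (u01 i).
Qed.

End cvg_aux.

Section disjoint_blocks.
Context {T : Type} {R : realType}.

Lemma prod_disjoint_blocks (A : nat -> set T) (v : nat -> R) n (x : T) :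
  trivIset setT A ->
  \prod_(j < n) (1 - v j) ^+ (x \in A j) = 1 - \sum_(j < n) v j * \1_(A j) x.
Proof.
move=> tA; elim: n => [|n IH]; first by rewrite !big_ord0 subr0.
rewrite !big_ord_recr/= IH indicE.
case: (boolP (x \in A n)) => xA; last by rewrite expr0 !mulr1 mulr0 addr0.
rewrite big1 => [|j _]; first by rewrite expr1 subr0 mul1r add0r mulr1.
rewrite indicE memNset ?mulr0// => xj.
have /trivIsetP/(_ j n Logic.I Logic.I) := tA.
rewrite neq_ltn ltn_ord => /(_ isT) h.
have : (A j `&` A n) x by split => //; exact: set_mem.
by rewrite h.
Qed.

End disjoint_blocks.

Section poisson_laplace.
Local Open Scope ereal_scope.
Context d (T : measurableType d) (R : realType) (P : probability T R).
Context d' (E : measurableType d') (mu : {measure set E -> \bar R}).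
Variables (lambda : R) (X : nat -> T -> E).
Hypothesis mX : forall i, measurable_fun setT (X i).
Hypothesis lambda0 : (0 <= lambda)%R.

Let count (A : set E) w : \bar R := \sum_(i <oo) (\1_A (X i w))%:E.

Hypothesis poissonX : forall n (A : 'I_n -> set E) (k : 'I_n -> nat),
  (forall j, measurable (A j)) -> (forall j, mu (A j) < +oo) ->
  trivIset setT A ->
  P [set w | forall j, count (A j) w = ((k j)%:R)%:E] =
  (\prod_(j < n) poisson_weight (lambda * fine (mu (A j))) (k j))%:E.

Section blocks.
Variables (A : nat -> set E) (c : nat -> R).
Hypothesis mA : forall j, measurable (A j).
Hypothesis finA : forall j, mu (A j) < +oo.
Hypothesis tA : trivIset setT A.
Hypothesis c01 : forall j, (0 <= c j <= 1)%R.

Let N j w := count (A j) w.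
Let rate j := (lambda * fine (mu (A j)))%R.

Let rate0 j : (0 <= rate j)%R.
Proof. by rewrite mulr_ge0// fine_ge0. Qed.

Let mN j : measurable_fun setT (N j).
Proof.
apply: ge0_emeasurable_sum => [k x _ _|k _]; first by rewrite lee_fin.
apply/measurable_EFinP; apply: (measurableT_comp _ (mX k)).
exact: measurable_indic.
Qed.

Let ev j l := [set w | N j w = (l%:R)%:E].

Let mev j l : measurable (ev j l).
Proof.
rewrite (_ : ev j l = N j @^-1` [set l%:R%:E])//.
by rewrite -[X in measurable X]setTI; apply: mN => //; exact: emeasurable_set1.
Qed.

Let evP j l : P (ev j l) = (poisson_weight (rate j) l)%:E.
Proof.
have := @poissonX 1%N (fun=> A j) (fun=> l) (fun=> mA j) (fun=> finA j).
rewrite big_ord1 => <-.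
  by congr (P _); apply/seteqP; split => w /=; [move=> wl _|move=> /(_ ord0)].
by apply/trivIsetP => i k _ _; rewrite (ord1 i) (ord1 k) eqxx.
Qed.

Let tev j : trivIset setT (ev j).
Proof.
apply/trivIsetP => k l _ _ kl; apply/seteqP; split => // w [wk wl].
have [/eqP] : k%:R%:E = l%:R%:E :> \bar R by exact: etrans (esym wk) wl.
by rewrite eqr_nat (negbTE kl).
Qed.

(** The Poisson weights have total mass 1, the generating function at 1, so the count is almost
    surely finite. *)
Let evT j : P (~` \bigcup_l ev j l) = 0.
Proof.
have mU : measurable (\bigcup_l ev j l) by exact: bigcup_measurable.
rewrite probability_setC//.
have -> : P (\bigcup_l ev j l) =
    \sum_(l <oo) (1 ^+ l * poisson_weight (rate j) l)%:E.
  rewrite measure_semi_bigcup//; apply: eq_eseriesr => l _.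
  by rewrite expr1n mul1r; exact: evP.
by rewrite poisson_generating_function// subrr mulr0 oppr0 expR0 subee.
Qed.

(* [c j ^+ N j], extended by the junk value [0] where [N j] is infinite *)
Let G j w := fine (\sum_(l <oo) (c j ^+ l * \1_(ev j l) w)%:E).

Let G_ev j l w : ev j l w -> G j w = (c j ^+ l)%R.
Proof.
have c0 : (0 <= c j)%R by case/andP: (c01 j).
move=> wl; rewrite /G (@nneseries_single _ _ l).
- by rewrite indicE mem_set//= mulr1.
- by move=> k; rewrite lee_fin mulr_ge0// exprn_ge0.
- move=> k kl; rewrite indicE memNset ?mulr0// => wk.
  have /trivIsetP/(_ k l Logic.I Logic.I kl) h := @tev j.
  have : (ev j k `&` ev j l) w by [].
  by rewrite h.
Qed.

Let mG j : measurable_fun setT (G j).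
Proof.
apply: measurableT_comp => //; apply: ge0_emeasurable_sum => [k x _ _|k _].
  by rewrite lee_fin mulr_ge0// exprn_ge0//; case/andP: (c01 j).
by apply/measurable_EFinP/measurable_funM => //; exact: measurable_indic.
Qed.

Let G0 j w : (0 <= G j w)%R.
Proof.
apply: fine_ge0; apply: nneseries_ge0 => k _ _.
by rewrite lee_fin mulr_ge0// exprn_ge0//; case/andP: (c01 j).
Qed.

(** Interpolates between the joint law of the counts, at [m = 0], and the expectation of the product
    of the [G j], at [m = n]. Each step sums over the value of [N m] and turns its Poisson weight
    into a generating function. *)
Let expect_blocks n m (k : nat -> nat) : (m <= n)%N ->
  \int[P]_(w in \bigcap_(j in [set j | (m <= j < n)%N]) ev j (k j))
    (\prod_(j < m) G j w)%:E =
  (\prod_(j < m) expR (- (rate j * (1 - c j))))%:E *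
  (\prod_(m <= j < n) poisson_weight (rate j) (k j))%:E.
Proof.
have mD m' k' : measurable (\bigcap_(j in [set j | (m' <= j < n)%N]) ev j (k' j)).
  by apply: bigcap_measurableType.
elim: m k => [|m IH] k mn.
  under eq_integral do rewrite big_ord0.
  rewrite integral_cst; last exact: mD.
  rewrite mul1e big_ord0 mul1e.
  rewrite big_mkord -(@poissonX n (fun j => A j) (fun j => k j))//.
  - congr (P _); apply/seteqP; split => w /= h.
      by move=> j; apply: h => /=.
    by move=> j /= jn; exact: (h (Ordinal jn)).
  - by move=> i j _ _ h; apply: val_inj; apply: tA h.
set D := \bigcap_(j in _) _.
have mDm : measurable D by exact: mD.
have mprod k' D' : measurable_fun D' (fun w => (\prod_(j < k') G j w)%:E).
  by apply/measurable_EFinP/measurable_funTS; apply: measurable_prod.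
(* The null event of an infinite [N m] is discarded, and the rest is partitioned by the value [l] of
   [N m]. *)
rewrite (@ge0_negligible_integral _ _ _ _ _ (~` \bigcup_l ev m l)); first last.
- exact: evT.
- by move=> w _; rewrite lee_fin prodr_ge0.
- exact: mprod.
- exact: mDm.
- by apply: measurableC; exact: bigcup_measurable.
have -> : D `\` ~` (\bigcup_l ev m l) = \bigcup_l (D `&` ev m l).
  by rewrite setDE setCK setI_bigcupr.
rewrite ge0_integral_bigcup; first last.
- exact: trivIset_setIl.
- by move=> w _; rewrite lee_fin prodr_ge0.
- exact: mprod.
- by move=> l; exact: measurableI.
pose k' l j := if j == m then l else k j.
have DE l : D `&` ev m l = \bigcap_(j in [set j | (m <= j < n)%N]) ev j (k' l j).
  apply/seteqP; split => [w [wD wl] j /= /andP[mj jn]|w h].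
    rewrite /k'; case: eqVneq => [->//|jm]; apply: wD => /=.
    by rewrite jn andbT ltn_neqAle eq_sym jm.
  split.
    move=> j /= /andP[mj jn]; have := h j; rewrite /= (ltnW mj) jn => /(_ isT).
    by rewrite /k' gtn_eqF.
  by have := h m; rewrite /= leqnn mn => /(_ isT); rewrite /k' eqxx.
have step l : \int[P]_(w in D `&` ev m l) (\prod_(j < m.+1) G j w)%:E =
    ((\prod_(j < m) expR (- (rate j * (1 - c j)))) *
     \prod_(m.+1 <= j < n) poisson_weight (rate j) (k j))%:E *
    (c m ^+ l * poisson_weight (rate m) l)%:E.
  transitivity (\int[P]_(w in D `&` ev m l)
      ((c m ^+ l)%:E * (\prod_(j < m) G j w)%:E)).
    apply: eq_integral => w; rewrite inE => -[_ wl].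
    by rewrite big_ord_recr/= (G_ev wl) -EFinM mulrC.
  rewrite ge0_integralZl; first last.
  - by rewrite lee_fin exprn_ge0//; case/andP: (c01 m).
  - by move=> w _; rewrite lee_fin prodr_ge0.
  - exact: mprod.
  - exact: measurableI.
  - rewrite DE IH ?(ltnW mn)// big_ltn//= /k' eqxx -!EFinM; congr EFin.
    rewrite (@eq_big_nat _ _ _ m.+1 n _ (fun j => poisson_weight (rate j) (k j))); last first.
      by move=> j /andP[mj _]; rewrite gtn_eqF.
    by ring.
under eq_eseriesr do rewrite step.
rewrite nneseriesZl; last first.
  move=> l _; rewrite lee_fin mulr_ge0 ?poisson_weight_ge0//.
  by rewrite exprn_ge0//; case/andP: (c01 m).
rewrite poisson_generating_function//; last by case/andP: (c01 m).
by rewrite big_ord_recr/= -!EFinM; congr EFin; ring.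
Qed.

(** After exchanging the products, the exponent of [c j] is the number of the first [m] points lying
    in [A j]. Almost surely these integers converge to a finite count, hence are eventually equal to
    it, and dominated convergence applies. *)
Lemma poisson_laplace_blocks n :
  (\int[P]_w (\prod_(i < m) \prod_(j < n) c j ^+ (X i w \in A j))%:E)
    @[m --> \oo] -->
  (expR (- (lambda * \sum_(j < n) fine (mu (A j)) * (1 - c j))))%:E.
Proof.
have intG : \int[P]_w (\prod_(j < n) G j w)%:E =
    (expR (- (lambda * \sum_(j < n) fine (mu (A j)) * (1 - c j))))%:E.
  have := @expect_blocks n n (fun=> 0%N) (leqnn n).
  rewrite (_ : \bigcap_(j in _) _ = setT); last first.
    apply/seteqP; split => // w _ j /= /andP[nj jn].
    by have := leq_ltn_trans nj jn; rewrite ltnn.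
  rewrite big_geq// mule1 => ->; rewrite -expR_sum; congr (expR _)%:E.
  rewrite mulr_sumr -sumrN; apply: eq_bigr => j _.
  by rewrite /rate mulrA.
rewrite -intG.
have mp m : measurable_fun setT
    (fun w => (\prod_(i < m) \prod_(j < n) c j ^+ (X i w \in A j))%R).
  apply: measurable_prod => i _; apply: measurable_prod => j _.
  rewrite (_ : (fun w => _) =
      ((fun x => c j * \1_(A j) x + (1 - \1_(A j) x))%R \o X i)); last first.
    apply/funext => w /=; rewrite indicE; case: (_ \in _) => /=.
      by rewrite expr1 mulr1 subrr addr0.
    by rewrite expr0 mulr0 subr0 add0r.
  apply: measurableT_comp => //; apply: measurable_funD.
    by apply: measurable_funM => //; exact: measurable_indic.
  by apply: measurable_funB => //; exact: measurable_indic.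
have p01 m w : (0 <= \prod_(i < m) \prod_(j < n) c j ^+ (X i w \in A j) <= 1)%R.
  apply/andP; split.
    apply: prodr_ge0 => i _; apply: prodr_ge0 => j _.
    by rewrite exprn_ge0//; case/andP: (c01 j).
  apply: prodr_ile1 => i _; apply/andP; split.
    by apply: prodr_ge0 => j _; rewrite exprn_ge0//; case/andP: (c01 j).
  apply: prodr_ile1 => j _; case/andP: (c01 j) => c0 c1.
  by rewrite exprn_ge0//= exprn_ile1.
have [] := @dominated_convergence _ _ _ P setT measurableT
  (fun m w => (\prod_(i < m) \prod_(j < n) c j ^+ (X i w \in A j))%:E)
  (fun w => (\prod_(j < n) G j w)%:E) (cst 1) => //.
- by move=> m; exact/measurable_EFinP.
- by apply/measurable_EFinP; exact: measurable_prod.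
- have aeN : {ae P, forall w, forall j, (\bigcup_l ev j l) w}.
    apply: ae_foralln => j; apply/negligibleP; last exact: evT.
    by apply: measurableC; exact: bigcup_measurable.
  apply: filterS aeN => w wev _.
  apply: cvg_EFin.
    by apply: nearW.
  rewrite (_ : fine \o _ = fun m =>
      (\prod_(j < n) c j ^+ (\sum_(i < m) (X i w \in A j)))%R); last first.
    apply/funext => m /=; rewrite exchange_big/=; apply: eq_bigr => j _.
    by rewrite expr_sum.
  have cvgj j : (c j ^+ (\sum_(i < m) (X i w \in A j)))%R @[m --> \oo] --> G j w.
    have [l _ wl] := wev j; rewrite (G_ev wl).
    apply: cvg_near_cst.
    have cvgS : (\sum_(i < m) (X i w \in A j))%:R%:E @[m --> \oo] --> (l%:R%:E : \bar R).
      rewrite -[X in _ --> X]wl /count.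
      rewrite [X in X @ _ --> _](_ : _ =
          fun m => \sum_(0 <= i < m) (\1_(A j) (X i w))%:E); last first.
        by apply/funext => m; rewrite big_mkord sumEFin natr_sum.
      by apply: is_cvg_nneseries => i _ _; rewrite lee_fin.
    by near do apply: congr1; exact: cvg_nat_eventually_eq cvgS.
  exact: (@cvg_prod_ord _ (fun j m => (c j ^+ (\sum_(i < m) (X i w \in A j)))%R)
    (fun j => G j w)).
- by apply: finite_measure_integrable_cst.
- apply: aeW => w m _ /=; rewrite lee_fin ger0_norm; by case/andP: (p01 m w).
Unshelve. all: by end_near. Qed.

End blocks.

Import HBNNSimple.

Lemma poisson_laplace_nnsfun (g : {nnsfun E >-> R}) :
  (forall x, g x <= 1)%R -> \int[mu]_x (g x)%:E < +oo ->
  (\int[P]_w (\prod_(i < m) (1 - g (X i w)))%:E) @[m --> \oo] -->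
  (expR (- (lambda * fine (\int[mu]_x (g x)%:E))))%:E.
Proof.
move=> g1 intg.
have [n [v [A [v0 mA tA gE]]]] := nnsfun_disjoint_blocks g.
have finA j : (j < n)%N -> mu (A j) < +oo.
  move=> jn; rewrite ltey; apply/eqP => Aoo.
  have : \int[mu]_x ((v j)%:E * (\1_(A j) x)%:E) <= \int[mu]_x (g x)%:E.
    apply: ge0_le_integral => //.
    - by move=> x _; rewrite -EFinM lee_fin mulr_ge0// ltW.
    - apply: emeasurable_funM; first exact: measurable_cst.
      by apply/measurable_EFinP; exact: measurable_indic.
    - by apply/measurable_EFinP; exact: measurable_funP.
    - move=> x _; rewrite -EFinM lee_fin gE (bigD1 (Ordinal jn))//= lerDl.
      by apply: sumr_ge0 => k _; rewrite mulr_ge0// ltW.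
  rewrite ge0_integralZl//; last 2 first.
  - by apply/measurable_EFinP; exact: measurable_indic.
  - by rewrite lee_fin ltW.
  by rewrite integral_indic// setIT Aoo gt0_muley ?lte_fin// leye_eq => /eqP h; rewrite h in intg.
(* Finite measure is known only for the blocks of index below [n]; the others are emptied. *)
pose A' j := if (j < n)%N then A j else set0.
have mA' j : measurable (A' j) by rewrite /A'; case: ifP.
have finA' j : mu (A' j) < +oo by rewrite /A'; case: ifPn => [/finA//|_]; rewrite measure0.
have tA' : trivIset setT A'.
  apply/trivIsetP => i j _ _ ij; rewrite /A'; case: ifP; case: ifP; rewrite ?set0I ?setI0// => _ _.
  by have /trivIsetP := tA; apply.
have gE' x : g x = (\sum_(j < n) v j * \1_(A' j) x)%R.
  by rewrite gE; apply: eq_bigr => j _; rewrite /A' ltn_ord.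
(* The bound [g x <= 1] limits [v j] only when some point lies in [A j]; an empty block gets the
   neutral factor 1 to keep [c j] in the unit interval. *)
pose c j := if (j < n)%N && (A j != set0) then (1 - v j)%R else 1%R.
have c01 j : (0 <= c j <= 1)%R.
  rewrite /c; case: ifPn => [/andP[jn /set0P[x Ax]]|_]; last by rewrite ler01 lexx.
  apply/andP; split; last by rewrite gerBl ltW.
  rewrite subr_ge0 (le_trans _ (g1 x))// gE (bigD1 (Ordinal jn))//=.
  rewrite indicE mem_set// mulr1 lerDl.
  by apply: sumr_ge0 => k _; rewrite mulr_ge0// ltW.
have := @poisson_laplace_blocks A' c mA' finA' tA' c01 n.
have prodE x : (\prod_(j < n) c j ^+ (x \in A' j) = 1 - g x)%R.
  rewrite gE' -prod_disjoint_blocks//; apply: eq_bigr => j _.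
  rewrite /A' /c ltn_ord/=; case: eqVneq => //= ->.
  by rewrite memNset.
under eq_cvg do under eq_integral do under eq_bigr do rewrite prodE.
suff -> : fine (\int[mu]_x (g x)%:E) = (\sum_(j < n) fine (mu (A' j)) * (1 - c j))%R.
  by [].
under eq_integral do rewrite gE' -sumEFin.
rewrite ge0_integral_sum//; last 2 first.
- by move=> j; apply/measurable_EFinP/measurable_funM => //; exact: measurable_indic.
- by move=> j x _; rewrite lee_fin mulr_ge0// ltW.
have term j : (j < n)%N -> \int[mu]_x (v j * \1_(A' j) x)%:E =
    (fine (mu (A' j)) * (1 - c j))%:E.
  move=> jn; under eq_integral do rewrite EFinM.
  rewrite ge0_integralZl//; last 2 first.
  - by apply/measurable_EFinP; exact: measurable_indic.
  - by rewrite lee_fin ltW.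
  rewrite integral_indic// setIT EFinM fineK ?ge0_fin_numE//.
  rewrite /c jn/= /A' jn muleC.
  by case: eqVneq => [->|_] /=; rewrite ?measure0 ?mul0e// subKr.
by under eq_bigr do rewrite term//; rewrite sumEFin.
Qed.

(** Simple functions [g n] increase to 1 - p. No exchange of limits is needed, because [a m n]
    decreases in [m] to [Cn n]: thus C <= Cn n <= a m n, and [n] to infinity gives C <= e m;
    conversely e m <= a m n, and [m] then [n] to infinity bounds the limit of [e] by C. *)
Lemma poisson_laplace (p : E -> R) :
  measurable_fun setT p -> (forall x, (0 <= p x <= 1)%R) ->
  \int[mu]_x (1 - p x)%:E < +oo ->
  (\int[P]_w (\prod_(i < m) p (X i w))%:E) @[m --> \oo] -->
  (expR (- (lambda * fine (\int[mu]_x (1 - p x)%:E))))%:E.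
Proof.
move=> mp p01 intp.
have mq : measurable_fun setT (fun x => (1 - p x)%:E).
  by apply/measurable_EFinP; exact: measurable_funB.
have q0 x : 0 <= (1 - p x)%:E by rewrite lee_fin subr_ge0; case/andP: (p01 x).
pose g := nnsfun_approx measurableT mq.
have gcvg x : (g n x)%:E @[n --> \oo] --> (1 - p x)%:E by exact: cvg_nnsfun_approx.
have gnd x : {homo (fun n => (g n x)%:E) : n m / (n <= m)%N >-> n <= m}.
  by move=> n m nm; rewrite lee_fin; exact/lefP/nd_nnsfun_approx.
have gle n x : (g n x <= 1 - p x)%R.
  rewrite -lee_fin -(cvg_lim _ (gcvg x))//.
  apply: lime_ge; first exact: cvgP (gcvg x).
  by exists n => // m /= nm; exact: gnd.
have g1 n x : (g n x <= 1)%R.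
  by rewrite (le_trans (gle n x))// gerBl; case/andP: (p01 x).
have intle n : \int[mu]_x (g n x)%:E <= \int[mu]_x (1 - p x)%:E.
  apply: ge0_le_integral => //.
  - by move=> x _; rewrite lee_fin.
  - by apply/measurable_EFinP; exact: measurable_funP.
  - by move=> x _; rewrite lee_fin.
have intg n : \int[mu]_x (g n x)%:E < +oo by exact: le_lt_trans (intle n) intp.
pose C := expR (- (lambda * fine (\int[mu]_x (1 - p x)%:E))).
pose Cn n := expR (- (lambda * fine (\int[mu]_x (g n x)%:E))).
have I_fin : \int[mu]_x (1 - p x)%:E \is a fin_num.
  by rewrite ge0_fin_numE// integral_ge0.
have In_fin n : \int[mu]_x (g n x)%:E \is a fin_num.
  by rewrite ge0_fin_numE// integral_ge0// => x _; rewrite lee_fin.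
have cvgCn : Cn n @[n --> \oo] --> C.
  have cvgI : (\int[mu]_x (g n x)%:E) @[n --> \oo] --> \int[mu]_x (1 - p x)%:E.
    have -> : \int[mu]_x (1 - p x)%:E = \int[mu]_x (limn (fun n => (g n x)%:E)).
      by apply: eq_integral => x _; apply/esym/cvg_lim => //; exact: gcvg.
    apply: cvg_monotone_convergence => //.
    - by move=> n; apply/measurable_EFinP; exact: measurable_funP.
    - by move=> n x _; rewrite lee_fin.
  apply: (@cvg_comp _ _ _ _ (@expR R)); last exact: continuous_expR.
  apply: cvgN; apply: cvgM; first exact: cvg_cst.
  by apply: fine_cvg; rewrite fineK.
have mprod m (u : nat -> T -> R) : (forall i, measurable_fun setT (u i)) ->
    measurable_fun setT (fun w => (\prod_(i < m) u i w)%:E).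
  by move=> mu'; apply/measurable_EFinP; exact: measurable_prod.
have mpX i : measurable_fun setT (fun w => p (X i w)).
  by apply: measurableT_comp => //; exact: mX.
have mgX n i : measurable_fun setT (fun w => 1 - g n (X i w))%R.
  apply: measurable_funB => //; apply: (measurableT_comp _ (mX i)).
  exact: measurable_funP.
have g01 n x : (0 <= 1 - g n x <= 1)%R by rewrite subr_ge0 g1 gerBl/=.
pose e m := \int[P]_w (\prod_(i < m) p (X i w))%:E.
pose a m n := \int[P]_w (\prod_(i < m) (1 - g n (X i w)))%:E.
have cvga n : a m n @[m --> \oo] --> (Cn n)%:E.
  exact: poisson_laplace_nnsfun.
have ea m n : e m <= a m n.
  apply: ge0_le_integral => //.
  - move=> w _; rewrite lee_fin; apply: prodr_ge0 => i _.
    by case/andP: (p01 (X i w)).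
  - exact: (mprod _ (fun i w => p (X i w))).
  - exact: (mprod _ (fun i w => 1 - g n (X i w))%R).
  - move=> w _; rewrite lee_fin; apply: ler_prod => i _.
    case/andP: (p01 (X i w)) => -> _ /=.
    by rewrite lerBrDr addrC -lerBrDr.
have a_ni n : {homo (a ^~ n) : m m' / (m <= m')%N >-> m' <= m}.
  move=> m m' mm'; apply: ge0_le_integral => //.
  - move=> w _; rewrite lee_fin; apply: prodr_ge0 => i _.
    by case/andP: (g01 n (X i w)).
  - exact: (mprod _ (fun i w => 1 - g n (X i w))%R).
  - exact: (mprod _ (fun i w => 1 - g n (X i w))%R).
  - move=> w _; rewrite lee_fin.
    exact: (prod_ord_nonincreasing (fun i => g01 n (X i w))).
have e_ni : {homo e : m m' / (m <= m')%N >-> m' <= m}.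
  move=> m m' mm'; apply: ge0_le_integral => //.
  - move=> w _; rewrite lee_fin; apply: prodr_ge0 => i _.
    by case/andP: (p01 (X i w)).
  - exact: (mprod _ (fun i w => p (X i w))).
  - exact: (mprod _ (fun i w => p (X i w))).
  - move=> w _; rewrite lee_fin.
    exact: (prod_ord_nonincreasing (fun i => p01 (X i w))).
have cvgae m : a m n @[n --> \oo] --> e m.
  have [] := @dominated_convergence _ _ _ P setT measurableT
    (fun n w => (\prod_(i < m) (1 - g n (X i w)))%:E)
    (fun w => (\prod_(i < m) p (X i w))%:E) (cst 1) => //.
  - by move=> n; exact: (mprod _ (fun i w => 1 - g n (X i w))%R).
  - exact: (mprod _ (fun i w => p (X i w))).
  - apply: aeW => w _; apply: cvg_EFin; first exact: nearW.
    apply: (@cvg_prod_ord _ (fun i n => 1 - g n (X i w))%R (fun i => p (X i w))).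
    move=> i; rewrite -[p (X i w)](subKr 1%R).
    apply: cvgB; first exact: cvg_cst.
    exact: (fine_cvg (gcvg (X i w))).
  - by apply: finite_measure_integrable_cst.
  - apply: aeW => w n _ /=; rewrite lee_fin ger0_norm.
      by apply: prodr_ile1 => i _; exact: g01.
    by apply: prodr_ge0 => i _; case/andP: (g01 n (X i w)).
have Ce m : C%:E <= e m.
  rewrite -(cvg_lim _ (cvgae m))//; apply: lime_ge; first exact: cvgP (cvgae m).
  apply: nearW => n; apply: (@le_trans _ _ (Cn n)%:E).
    rewrite lee_fin ler_expR lerN2 ler_wpM2l//.
    by apply: fine_le.
  rewrite -(cvg_lim _ (cvga n))//; apply: lime_le; first exact: cvgP (cvga n).
  by exists m => // m' /= mm'; exact: a_ni.
have cvge := ereal_nonincreasing_cvgn e_ni.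
have ecvg : cvgn e by exact: cvgP cvge.
suff <- : limn e = C%:E by [].
apply/eqP; rewrite eq_le; apply/andP; split; last first.
  by apply: lime_ge => //; exact: nearW.
have limeC n : limn e <= (Cn n)%:E.
  rewrite -(cvg_lim _ (cvga n))//; apply: lee_lim => //.
    exact: cvgP (cvga n).
  by apply: nearW => m; exact: ea.
have cvgCnE : (Cn n)%:E @[n --> \oo] --> C%:E.
  by apply: cvg_EFin => //; exact: nearW.
rewrite -(cvg_lim _ cvgCnE)//; apply: lime_ge; first exact: cvgP cvgCnE.
exact: nearW.
Qed.

End poisson_laplace.

(** * Area of a disc *)

Section disc.
Context {R : realType}.
Local Notation mu := (@lebesgue_measure R).

Lemma continuous_oo_LR (F : R -> R) a b : continuous F ->
  (forall x, derivable F x 1) -> derivable_oo_LRcontinuous F a b.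
Proof.
move=> cF dF; split; first by move=> x _; exact: dF.
- by apply: cvg_at_right_filter; exact: cF.
- by apply: cvg_at_left_filter; exact: cF.
Qed.

Lemma integral_cos2 :
  (\int[mu]_(t in `[(- (pi / 2))%R, (pi / 2)%R]) (2 * cos t ^+ 2)%:E = pi%:E)%E.
Proof.
have pi0 : - (pi / 2) < pi / 2 :> R by rewrite gtrN// divr_gt0// pi_gt0.
pose F (t : R) : R := t + sin t * cos t.
have dF (x : R) : is_derive x (1 : R) F (2 * cos x ^+ 2).
  rewrite /F; apply: is_derive_eq.
  rewrite /GRing.scale/=.
  have := cos2Dsin2 x; rewrite !expr2; lra.
rewrite (@continuous_FTC2 _ _ F)//.
- rewrite /F sinN cosN cos_pihalf !mulr0 !addr0 -EFinB opprK.
  by congr EFin; lra.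
- apply: continuous_subspaceT => x.
  apply: cvgM; first exact: cvg_cst.
  apply: (@cvg_comp _ _ _ cos (fun y => y ^+ 2)); first exact: continuous_cos.
  exact: exprn_continuous.
- apply: continuous_oo_LR => x; last by have [] := dF x.
  by apply/differentiable_continuous/derivable1_diffP; have [] := dF x.
- by move=> x _; rewrite derive1E; have [_ ->] := dF x.
Qed.

Lemma integral_half_disc (r : R) : 0 < r ->
  (\int[mu]_(x in `[(- r)%R, r]) (2 * Num.sqrt (r ^+ 2 - x ^+ 2))%:E =
   (pi * r ^+ 2)%:E)%E.
Proof.
move=> r0.
have pi0 : - (pi / 2) < pi / 2 :> R by rewrite gtrN// divr_gt0// pi_gt0.
pose F (t : R) : R := r * sin t.
have dF (x : R) : is_derive x (1 : R) F (r * cos x).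
  rewrite /F; apply: is_derive_eq.
  by rewrite /GRing.scale/=.
have dFE : derive1 F = (fun x => r * cos x).
  by apply/funext => x; rewrite derive1E; have [_ ->] := dF x.
have cF' : continuous (derive1 F).
  by rewrite dFE => x; apply: cvgM; [exact: cvg_cst|exact: continuous_cos].
have cF : continuous F.
  by move=> x; apply: cvgM; [exact: cvg_cst|exact: continuous_sin].
transitivity (\int[mu]_(x in `[F (- (pi / 2))%R, F (pi / 2)%R])
    (2 * Num.sqrt (r ^+ 2 - x ^+ 2))%:E)%E.
  by rewrite /F sinN sin_pihalf mulrN1 mulr1.
rewrite (@integration_by_substitution_increasing _ F)//.
- transitivity (\int[mu]_(t in `[(- (pi / 2))%R, (pi / 2)%R])
    ((r ^+ 2)%:E * (2 * cos t ^+ 2)%:E))%E.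
    apply: eq_integral => t; rewrite inE/= in_itv/= => tI.
    rewrite -EFinM; congr EFin.
    rewrite /F !mulrfctE/= dFE exprMn -{1}(mulr1 (r ^+ 2)) -mulrBr -cos2sin2.
    rewrite sqrtrM ?sqr_ge0// !sqrtr_sqr !ger0_norm ?cos_ge0_pihalf//; last exact: ltW.
    by rewrite !expr2; ring.
  rewrite ge0_integralZl//.
  + by rewrite integral_cos2 -EFinM mulrC.
  + apply/measurable_EFinP/measurable_funTS; apply: measurable_funM => //.
    apply: measurable_funX; apply: continuous_measurable_fun.
    exact: continuous_cos.
  + by move=> t _; rewrite lee_fin mulr_ge0// sqr_ge0.
  + by rewrite lee_fin sqr_ge0.
- exact: ltW.
- move=> x y xI yI xy; rewrite /F ltr_pM2l//.
  by rewrite ltr_sin.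
- by apply/cvg_ex; exists (derive1 F (- (pi / 2))); apply: cvg_at_right_filter; exact: cF'.
- by apply/cvg_ex; exists (derive1 F (pi / 2)); apply: cvg_at_left_filter; exact: cF'.
- by apply: continuous_oo_LR => // x; have [] := dF x.
- apply: continuous_subspaceT => x.
  apply: cvgM; first exact: cvg_cst.
  apply: (@cvg_comp _ _ _ _ Num.sqrt); last exact: sqrt_continuous.
  by apply: cvgB; [exact: cvg_cst|exact: exprn_continuous].
Qed.

Lemma disc_area (v : R) :
  ((mu \x mu) [set x : R * R | (x.1 ^+ 2 + x.2 ^+ 2 < v)%R] =
   (pi * Num.max v 0)%:E)%E.
Proof.
rewrite /product_measure1/=.
(* [Num.sqrt] is 0 on negative numbers, so the same formula yields an empty interval for the slices
   that miss the disc. *)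
have secE (x : R) : xsection [set x : R * R | x.1 ^+ 2 + x.2 ^+ 2 < v] x =
    `](- Num.sqrt (v - x ^+ 2)), (Num.sqrt (v - x ^+ 2))[%classic.
  apply/seteqP; split => y; rewrite /xsection/= inE/= in_itv/= -ltr_norml.
    move=> h; rewrite -sqrtr_sqr ltr_sqrt; first by rewrite ltrBrDl.
    by rewrite subr_gt0; apply: le_lt_trans h; rewrite lerDl sqr_ge0.
  move=> h.
  have v0 : 0 < v - x ^+ 2 by rewrite -sqrtr_gt0; exact: le_lt_trans h.
  by move: h; rewrite -sqrtr_sqr ltr_sqrt// ltrBrDl.
have muE (x : R) : mu (xsection [set x : R * R | x.1 ^+ 2 + x.2 ^+ 2 < v] x) =
    (2 * Num.sqrt (v - x ^+ 2))%:E.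
  rewrite secE lebesgue_measure_itv/= lte_fin -subr_gt0 opprK.
  have s0 := sqrtr_ge0 (v - x ^+ 2).
  case: ltP => h; rewrite ?EFinN -?EFinB ?opprK.
    by congr EFin; lra.
  by congr EFin; lra.
under eq_integral do rewrite /= muE.
have [v0|v0] := ltP 0 v; last first.
  rewrite mulr0; apply: integral0_eq => x _.
  rewrite ler0_sqrtr ?mulr0//.
  by rewrite subr_le0 (le_trans v0)// sqr_ge0.
pose r := Num.sqrt v.
have r0 : 0 < r by rewrite sqrtr_gt0.
have vE : v = r ^+ 2 by rewrite sqr_sqrtr// ltW.
rewrite vE -integral_half_disc// [RHS]integral_mkcond.
apply: eq_integral => x _; rewrite patchE; case: ifPn => // xI.
rewrite ler0_sqrtr ?mulr0//.
rewrite subr_le0 leNgt; apply: contraNN xI => xr.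
rewrite inE/= in_itv/= -ler_norml -(ger0_norm (ltW r0)) -ler_sqr ?nnegrE//.
by rewrite !real_normK// ?num_real// ltW.
Qed.

End disc.

(** * The mean measure of the losses *)

Section real_integrals.
Context {R : realType}.
Local Notation mu := (@lebesgue_measure R).

Let is_derive_NexpRN (x : R) : is_derive x 1 (fun t : R => - expR (- t)) (expR (- x)).
Proof. by apply: is_derive_eq; rewrite /GRing.scale/= mulrN1 opprK. Qed.

Let continuous_NexpRN : continuous (fun t : R => - expR (- t)).
Proof.
move=> x; apply/differentiable_continuous/derivable1_diffP.
by have [] := is_derive_NexpRN x.
Qed.

Let continuous_expRN : continuous (fun t : R => expR (- t)).
Proof.
move=> x; apply: (@cvg_comp _ _ _ _ expR); last exact: continuous_expR.
by apply: cvgN; exact: cvg_id.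
Qed.

Lemma measurable_expRN (D : set R) : measurable_fun D (fun t : R => expR (- t)).
Proof.
apply: measurable_funTS; apply: continuous_measurable_fun.
exact: continuous_expRN.
Qed.

Lemma integral_expRNy (c : R) : (\int[mu]_(t in `]c, +oo[) (expR (- t))%:E = (expR (- c))%:E)%E.
Proof.
rewrite integral_itv_obnd_cbnd; last by apply/measurable_EFinP; exact: measurable_expRN.
rewrite (@ge0_continuous_FTC2y _ _ (fun t : R => - expR (- t)) _ 0).
- by rewrite sub0e EFinN oppeK.
- by move=> x _; exact: expR_ge0.
- by apply: continuous_subspaceT; exact: continuous_expRN.
- by rewrite -oppr0; apply: cvgN; exact: cvgr_expR.
- by move=> x _; have [] := is_derive_NexpRN x.
- by apply: cvg_at_right_filter; exact: continuous_NexpRN.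
- by move=> x _; rewrite derive1E; have [_ ->] := is_derive_NexpRN x.
Qed.

Lemma integral_expRN0c (c : R) : 0 <= c ->
  (\int[mu]_(t in `]0%R, c[) (expR (- t))%:E = (1 - expR (- c))%:E)%E.
Proof.
rewrite le_eqVlt => /predU1P[<-|c0].
  by rewrite set_itvoo0 integral_set0 oppr0 expR0 subrr.
rewrite integral_itv_bndo_bndc; last by apply/measurable_EFinP; exact: measurable_expRN.
rewrite integral_itv_obnd_cbnd; last by apply/measurable_EFinP; exact: measurable_expRN.
rewrite (@continuous_FTC2 _ _ (fun t : R => - expR (- t)))//.
- by rewrite -EFinB oppr0 expR0; congr EFin; ring.
- by apply: continuous_subspaceT; exact: continuous_expRN.
- apply: continuous_oo_LR; first exact: continuous_NexpRN.
  by move=> x; have [] := is_derive_NexpRN x.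
- by move=> x _; rewrite derive1E; have [_ ->] := is_derive_NexpRN x.
Qed.

Let measurable_powRc (D : set R) (r : R) : measurable_fun D (fun t : R => t `^ r).
Proof. by apply: measurable_funTS; exact: measurable_powR. Qed.

(** The bound is independent of [e], so it survives the limit at 0, where the power may be
    singular. *)
Lemma integral_powR_le (r e z : R) : -1 < r -> 0 < e -> e < z ->
  (\int[mu]_(t in `[e, z]) (t `^ r)%:E <= (z `^ (r + 1) / (r + 1))%:E)%E.
Proof.
move=> r1 e0 ez.
have r0 : 0 < r + 1 by lra.
have dF (x : R) : 0 < x ->
    is_derive x (1 : R) (fun t : R => (r + 1)^-1 * t `^ (r + 1)) (x `^ r).
  move=> x0; have ? := is_derive1_powR (r + 1) x0.
  apply: is_derive_eq; rewrite /GRing.scale/=.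
  by rewrite mulrA mulVf ?gt_eqF// mul1r; congr (_ `^ _); ring.
have cF (x : R) : 0 < x -> {for x, continuous (fun t : R => (r + 1)^-1 * t `^ (r + 1))}.
  move=> x0; apply/differentiable_continuous/derivable1_diffP.
  by have [] := dF x x0.
have cf (x : R) : 0 < x -> {for x, continuous (fun t : R => t `^ r)}.
  move=> x0; apply/differentiable_continuous/derivable1_diffP.
  by have [] := is_derive1_powR r x0.
rewrite (@continuous_FTC2 _ _ (fun t : R => (r + 1)^-1 * t `^ (r + 1)))//.
- rewrite -EFinB lee_fin mulrC gerBl mulr_ge0 ?powR_ge0// invr_ge0; exact: ltW.
- apply: continuous_in_subspaceT => x; rewrite inE/= in_itv/= => /andP[ex _].
  by apply: cf; exact: lt_le_trans ex.
- split.
  + move=> x; rewrite in_itv/= => /andP[ex _].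
    by have [] := dF x (lt_trans e0 ex).
  + by apply: cvg_at_right_filter; apply: cF.
  + by apply: cvg_at_left_filter; apply: cF; exact: lt_trans ez.
- move=> x; rewrite in_itv/= => /andP[ex _]; rewrite derive1E.
  by have [_ ->] := dF x (lt_trans e0 ex).
Qed.

Lemma integral_powR_expRN_fin (r z : R) : -1 < r -> 0 <= z ->
  (\int[mu]_(t in `[0%R, z]) (t `^ r * expR (- t))%:E)%E \is a fin_num.
Proof.
move=> r1; rewrite le_eqVlt => /predU1P[<-|z0].
  by rewrite set_itv1 integral_set1.
have f0 t : (0 <= (t `^ r * expR (- t))%:E)%E.
  by rewrite lee_fin mulr_ge0 ?powR_ge0 ?expR_ge0.
have mf (D : set R) : measurable_fun D (fun t : R => (t `^ r * expR (- t))%:E).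
  apply/measurable_EFinP; apply: measurable_funM; first exact: measurable_powRc.
  exact: measurable_expRN.
rewrite ge0_fin_numE ?integral_ge0//.
rewrite -integral_itv_obnd_cbnd//.
(* With [n.+2] the left endpoint is strictly below [z] even at [n = 0], as the bound on power
   integrals requires. *)
pose F n := `[z / n.+2%:R, z]%classic : set R.
have -> : `]0, z]%classic = \bigcup_n F n.
  apply/seteqP; split => x /=; rewrite in_itv/=.
    move=> /andP[x0 xz]; exists (Num.bound (z / x)) => //=.
    rewrite /F/= in_itv/= xz andbT ler_pdivrMr// mulrC -ler_pdivrMr//.
    have zx0 : 0 <= z / x by rewrite divr_ge0// ltW.
    apply: (le_trans (ltW (archi_boundP zx0))).
    by rewrite ler_nat; do 2 apply: leqW.
  move=> [n _]; rewrite /F/= in_itv/= => /andP[zx ->]; rewrite andbT.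
  by apply: lt_le_trans zx; rewrite divr_gt0.
have bound n : (\int[mu]_(t in F n) (t `^ r * expR (- t))%:E <=
    (z `^ (r + 1) / (r + 1))%:E)%E.
  have zn0 : 0 < z / n.+2%:R by rewrite divr_gt0.
  apply: (@le_trans _ _ (\int[mu]_(t in F n) (t `^ r)%:E)%E).
    apply: ge0_le_integral => //.
    - exact: measurable_itv.
    - exact: mf.
    - by apply/measurable_EFinP; exact: measurable_powRc.
    - move=> t; rewrite /F/= in_itv/= => /andP[zt _].
      rewrite lee_fin ler_piMr ?powR_ge0// -expR0 ler_expR oppr_le0.
      by apply: le_trans zt; exact: ltW.
  apply: integral_powR_le => //.
  by rewrite ltr_pdivrMr// ltr_pMr// ltr1n.
have ndF : nondecreasing_seq F.
  apply/nondecreasing_seqP => n; rewrite subsetEset => x.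
  rewrite /F/= !in_itv/= => /andP[zx ->]; rewrite andbT; apply: le_trans zx.
  by rewrite ler_pM2l// lef_pV2 ?posrE// ler_nat.
have cvgF : (\int[mu]_(t in F n) (t `^ r * expR (- t))%:E @[n --> \oo] -->
    \int[mu]_(t in \bigcup_n F n) (t `^ r * expR (- t))%:E)%E.
  apply: ge0_nondecreasing_set_cvg_integral => //.
    by move=> n; exact: measurable_itv.
  by move=> n; exact: mf.
rewrite -(cvg_lim _ cvgF)//.
apply: (@le_lt_trans _ _ (z `^ (r + 1) / (r + 1))%:E); last exact: ltry.
by apply: lime_le; [exact: cvgP cvgF|exact: nearW].
Qed.

End real_integrals.

Section measurable_aux.
Context {R : realType}.

(** Inversion is discontinuous at 0; measurability comes from that of [powR], applied separately to
    each sign. *)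
Lemma measurable_invr : measurable_fun setT (@GRing.inv R).
Proof.
rewrite (_ : GRing.inv = fun x : R =>
    if 0 <= x then x `^ (-1) else - ((- x) `^ (-1))); last first.
  apply/funext => x; case: leP => x0; first by rewrite powR_inv1.
  by rewrite powR_inv1 ?oppr_ge0 ?ltW// invrN opprK.
apply: measurable_fun_ifT.
- by apply: measurable_fun_ler.
- exact: measurable_powR.
- apply: measurable_funN; apply: (measurableT_comp (measurable_powR (-1))).
  exact: measurable_funN.
Qed.

Lemma measurable_set_ltr d (T : measurableType d) (f g : T -> R) :
  measurable_fun setT f -> measurable_fun setT g ->
  measurable [set x | f x < g x].
Proof.
move=> mf mg; rewrite (_ : [set x | _] = (fun x => f x < g x) @^-1` [set true])//.
by rewrite -[X in measurable X]setTI; apply: measurable_fun_ltr.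
Qed.

End measurable_aux.

Section plane_measure.
Context {R : realType}.
Local Notation mu := (@lebesgue_measure R).

(* The library's product of two measures is canonically sigma-finite only when
   both factors are finite. *)
Definition plane_measure := (mu \x mu)%E.

HB.instance Definition _ := Measure.on plane_measure.

Let plane_sigma_finite : sigma_finite setT plane_measure.
Proof.
exists (fun n => [set x : R * R | x.1 ^+ 2 + x.2 ^+ 2 < n%:R]).
  apply/seteqP; split => // x _ /=.
  have x0 : 0 <= x.1 ^+ 2 + x.2 ^+ 2 by rewrite addr_ge0 ?sqr_ge0.
  by exists (Num.bound (x.1 ^+ 2 + x.2 ^+ 2)) => //=; exact: archi_boundP.
move=> n; split; last by rewrite /plane_measure disc_area ltry.
apply: measurable_set_ltr => //.
by apply: measurable_funD; apply: measurable_funX.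
Qed.

HB.instance Definition _ := Measure_isSigmaFinite.Build _ _ _ plane_measure
  plane_sigma_finite.

End plane_measure.

(** * Integrals of the loss weights over the plane *)

Section loss.
Context {R : realType}.
Variables (K beta : R).
Hypotheses (K0 : 0 < K) (beta2 : 2 < beta).
Local Notation mu := (@lebesgue_measure R).
Local Notation plane := (@plane_measure R).

Definition loss (x : R * R) (sigma : R) : R :=
  (K * euclidean_norm x) `^ beta / sigma.

Let d0 : 0 < 2 / beta.
Proof. by rewrite divr_gt0// (lt_trans _ beta2). Qed.

Lemma ltr_powR_mono (r a b : R) : 0 < r -> 0 <= a -> 0 <= b ->
  (a `^ r < b `^ r) = (a < b).
Proof.
move=> r0 a0 b0; apply/idP/idP.
  by apply: contraLR; rewrite -!leNgt; apply: ge0_ler_powR; rewrite ?nnegrE// ltW.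
by apply: gt0_ltr_powR; rewrite ?nnegrE.
Qed.

Lemma loss_ge0 x sigma : 0 <= sigma -> 0 <= loss x sigma.
Proof. by move=> s0; rewrite divr_ge0// powR_ge0. Qed.

Lemma measurable_euclidean_norm : measurable_fun setT (@euclidean_norm R).
Proof.
have msqrt : measurable_fun setT (@Num.sqrt R).
  by apply: continuous_measurable_fun; exact: sqrt_continuous.
have h : measurable_fun setT (fun x : R * R => x.1 ^+ 2 + x.2 ^+ 2).
  by apply: measurable_funD; apply: measurable_funX.
exact: (measurableT_comp msqrt h).
Qed.

Lemma measurable_loss : measurable_fun setT (fun y : (R * R) * R => loss y.1 y.2).
Proof.
apply: measurable_funM; last exact: (measurableT_comp measurable_invr).
have mn := measurableT_comp measurable_euclidean_norm
  (@measurable_fst _ _ (R * R)%type R).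
exact: (measurableT_comp (measurable_powR beta) (measurable_funM (measurable_cst K) mn)).
Qed.

Lemma measurable_loss1 sigma : measurable_fun setT (fun x : R * R => loss x sigma).
Proof.
exact: (measurableT_comp measurable_loss
  (measurable_fun_pair (@measurable_id _ (R * R)%type _) (measurable_cst sigma))).
Qed.

(** A loss below [t] means a squared norm below (sigma t)^(2/beta) / K^2; this is the origin of the
    exponent 2/beta and of the factor pi / K^2. *)
Lemma loss_disc_area (sigma t : R) : 0 < sigma -> 0 < t ->
  (plane [set x | (loss x sigma < t)%R] =
   (pi / K ^+ 2 * (sigma * t) `^ (2 / beta))%:E)%E.
Proof.
move=> sigma0 t0.
rewrite (_ : [set x | _] =
    [set x : R * R | x.1 ^+ 2 + x.2 ^+ 2 < (sigma * t) `^ (2 / beta) / K ^+ 2]).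
  rewrite [LHS](disc_area _) max_l ?divr_ge0 ?powR_ge0 ?sqr_ge0//.
  by rewrite mulrA mulrAC.
apply: eq_set => x; congr is_true.
rewrite /loss ltr_pdivrMr// mulrC.
rewrite -(@ltr_powR_mono (2 / beta))// ?powR_ge0 ?mulr_ge0 1?ltW//.
rewrite -powRrM mulrCA divff ?gt_eqF ?(lt_trans _ beta2)// mulr1 powR_mulrn; last first.
  by rewrite mulr_ge0 ?sqrtr_ge0// ltW.
rewrite exprMn /euclidean_norm sqr_sqrtr ?addr_ge0 ?sqr_ge0//.
by rewrite ltr_pdivlMr ?exprn_gt0// mulrC [t * _]mulrC.
Qed.

(* The contribution of a loss [t] to the infinite product which equals
   [exp (- u * sum_i 1 / L_i)] on [L >= s], and [0] elsewhere. *)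
Definition loss_weight (s u t : R) : R := if s <= t then expR (- (u / t)) else 0.

Lemma loss_weight01 s u t : 0 < s -> 0 <= u -> 0 <= loss_weight s u t <= 1.
Proof.
move=> s0 u0; rewrite /loss_weight; case: ifPn => st; last by rewrite lexx ler01.
rewrite expR_ge0/= -expR0 ler_expR oppr_le0 divr_ge0//.
by apply: le_trans st; exact: ltW.
Qed.

Lemma measurable_loss_weight s u : measurable_fun setT (loss_weight s u).
Proof.
apply: measurable_fun_ifT => //; first exact: measurable_fun_ler.
apply: (measurableT_comp (@measurable_expR R)); apply: measurable_funN.
by apply: measurable_funM => //; exact: measurable_invr.
Qed.

Lemma integral_loss (sigma s z : R) : 0 < sigma -> 0 < s -> 0 <= z ->
  (\int[plane]_x
     (1 - loss_weight s (z * s) (loss x sigma))%:E =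
   (pi / K ^+ 2 * sigma `^ (2 / beta) * s `^ (2 / beta) * varphi beta z)%:E)%E.
Proof.
move=> sigma0 s0 z0; set u := z * s.
have u0 : 0 <= u by rewrite mulr_ge0// ltW.
(* [D] lies above each point x: all t > 0 when the loss is below [s], where the missing weight is 1,
   and 0 < t < u / loss otherwise. The product form avoids dividing by a loss that may be 0. *)
pose D := [set y : (R * R) * R | 0 < y.2 /\
  (loss y.1 sigma < s \/ loss y.1 sigma * y.2 < u)].
have m1 : measurable_fun setT (fun y : (R * R) * R => loss y.1 sigma).
  exact: (measurableT_comp (measurable_loss1 sigma) (@measurable_fst _ _ (R * R)%type R)).
have mD : measurable D.
  rewrite (_ : D = [set y | 0 < y.2] `&`
    ([set y | loss y.1 sigma < s] `|` [set y | loss y.1 sigma * y.2 < u]))//.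
  apply: measurableI; first exact: measurable_set_ltr.
  apply: measurableU; first exact: measurable_set_ltr.
  by apply: measurable_set_ltr => //; exact: measurable_funM.
pose h (y : (R * R) * R) := (\1_D y * expR (- y.2))%:E.
have h0 y : (0 <= h y)%E by rewrite lee_fin mulr_ge0// expR_ge0.
have mh : measurable_fun setT h.
  apply/measurable_EFinP; apply: measurable_funM; first exact: measurable_indic.
  exact: (measurableT_comp (@measurable_expRN R setT) (@measurable_snd _ _ (R * R)%type R)).
have hx x : (\int[mu]_t h (x, t) =
    (1 - loss_weight s u (loss x sigma))%:E)%E.
  rewrite /loss_weight; have [sl|ls] := leP s (loss x sigma).
    have l0 : 0 < loss x sigma by exact: lt_le_trans sl.
    have ul0 : 0 <= u / loss x sigma by rewrite divr_ge0// ltW.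
    rewrite -(integral_expRN0c ul0) [RHS]integral_mkcond.
    apply: eq_integral => t _; rewrite patchE /h.
    have -> : (t \in `]0, (u / loss x sigma)[%classic) = ((x, t) \in D).
      apply/idP/idP; rewrite !inE/= in_itv/= ltr_pdivlMr//.
        by move=> /andP[t0 tu]; split=> //; right; rewrite /= mulrC.
      by move=> [/= -> [|]]; [rewrite ltNge sl|rewrite mulrC].
    by rewrite indicE; case: (_ \in D); rewrite ?mul1r ?mul0r.
  rewrite subr0 -expR0 -[X in expR X]oppr0 -integral_expRNy [RHS]integral_mkcond.
  apply: eq_integral => t _; rewrite patchE /h.
  have -> : (t \in `]0, +oo[%classic) = ((x, t) \in D).
    apply/idP/idP; rewrite !inE/= in_itv/= andbT; last by case.
    by move=> t0; split=> //; left.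
  by rewrite indicE; case: (_ \in D); rewrite ?mul1r ?mul0r.
pose c := pi / K ^+ 2 * sigma `^ (2 / beta) * s `^ (2 / beta).
have c0 : 0 <= c.
  by rewrite !mulr_ge0 ?powR_ge0// ?invr_ge0 ?sqr_ge0// pi_ge0.
(* At height t, [D] is the disc of losses below max(s, u/t) = s max(1, z/t). Its area changes form
   at t = z: below, it produces the incomplete gamma function, above, the term exp (- z) of
   [varphi]. *)
pose k (t : R) : \bar R :=
  (c * (if t <= z then z `^ (2 / beta) * t `^ (- (2 / beta)) else 1) * expR (- t))%:E.
have ht t : 0 < t -> (\int[plane]_x h (x, t) = k t)%E.
  move=> t0.
  transitivity (\int[plane]_x ((expR (- t))%:E *
    (\1_[set x | (loss x sigma < Num.max s (u / t))%R] x)%:E))%E.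
    apply: eq_integral => x _; rewrite /h -EFinM mulrC; congr (_ * _)%:E.
    rewrite !indicE; congr (_ : bool)%:R.
    apply/idP/idP; rewrite !inE/= lt_max ltr_pdivlMr//.
      by move=> [_ [->//|->]]; rewrite orbT.
    by move=> /orP ht; split.
  have mt : measurable [set x | loss x sigma < Num.max s (u / t)].
    by apply: measurable_set_ltr => //; exact: measurable_loss1.
  rewrite ge0_integralZl; first last.
  - by rewrite lee_fin expR_ge0.
  - by move=> x _; rewrite lee_fin.
  - by apply/measurable_EFinP; exact: measurable_indic.
  - exact: measurableT.
  rewrite integral_indic//.
  have tm0 : 0 < Num.max s (u / t) by rewrite lt_max s0.
  rewrite setIT [X in (_ * X)%E](loss_disc_area sigma0 tm0) -EFinM /k; congr EFin.
  have -> : Num.max s (u / t) = s * (if t <= z then z / t else 1).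
    case: (leP t z) => tz.
      rewrite max_r /u; last by rewrite ler_pdivlMr// mulrC ler_pM2r.
      by rewrite mulrAC mulrC.
    by rewrite mulr1 max_l// /u ler_pdivrMr// mulrC ler_pM2l// ltW.
  have w0 : 0 <= (if t <= z then z / t else 1).
    by case: ifP; rewrite ?divr_ge0// ltW.
  rewrite mulrC; congr (_ * _); rewrite /c.
  rewrite mulrA powRM ?mulr_ge0 ?(ltW sigma0) ?(ltW s0)//.
  rewrite powRM ?(ltW sigma0) ?(ltW s0)// !mulrA; congr (_ * _).
  case: ifP => _; last by rewrite powR1.
  by rewrite powRM ?invr_ge0 ?(ltW t0)// -(@powR_inv1 _ t) ?(ltW t0)// -powRrM mulN1r.
transitivity (\int[plane]_x \int[mu]_t h (x, t))%E.
  by apply: eq_integral => x _; rewrite hx.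
transitivity (\int[mu]_t \int[plane]_x h (x, t))%E.
  exact: (@fubini_tonelli _ _ _ _ R (@plane_measure R) mu h mh h0).
transitivity (\int[mu]_(t in `]0%R, +oo[) k t)%E.
  rewrite [RHS]integral_mkcond; apply: eq_integral => t _; rewrite patchE.
  case: ifPn; rewrite ?inE ?notin_setE/= in_itv/= andbT; first exact: ht.
  move=> /negP; rewrite -leNgt => t0; apply: integral0_eq => x _.
  by rewrite /h indicE memNset ?mul0r//= => -[]; rewrite ltNge t0.
have k0 t : (0 <= k t)%E.
  rewrite lee_fin mulr_ge0 ?expR_ge0// mulr_ge0//.
  by case: ifP => _ //; rewrite mulr_ge0// powR_ge0.
have -> : `]0, +oo[%classic = `]0, z] `|` `]z, +oo[ :> set R.
  by rewrite -itv_bndbnd_setU// bnd_simp.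
have mk (A : set R) : measurable A -> measurable_fun A k.
  move=> mA; apply: measurable_funTS; apply/measurable_EFinP.
  apply: measurable_funM; last exact: measurable_expRN.
  apply: measurable_funM => //; apply: measurable_fun_ifT.
  - exact: measurable_fun_ler.
  - by apply: measurable_funM => //; exact: measurable_powR.
  - exact: measurable_cst.
rewrite ge0_integral_setU; first last.
- rewrite disj_set2E; apply/eqP/seteqP; split => // t /= [].
  by rewrite !in_itv/= andbT => /andP[_ tz]; rewrite ltNge tz.
- by move=> t _; exact: k0.
- by apply: mk; apply: measurableU; exact: measurable_itv.
- exact: measurable_itv.
- exact: measurable_itv.
have -> : (\int[mu]_(t in `]z, +oo[) k t = c%:E * (expR (- z))%:E)%E.
  rewrite -integral_expRNy -ge0_integralZl; first last.
  - by rewrite lee_fin.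
  - by move=> t _; rewrite lee_fin expR_ge0.
  - by apply/measurable_EFinP; exact: measurable_expRN.
  - exact: measurable_itv.
  apply: eq_integral => t; rewrite inE/= in_itv/= andbT => zt.
  by rewrite /k leNgt zt/= mulr1 EFinM.
have -> : (\int[mu]_(t in `]0%R, z]) k t = (c * z `^ (2 / beta))%:E *
    (lower_incomplete_gamma (1 - 2 / beta) z)%:E)%E.
  have alphaE : 1 - 2 / beta - 1 = - (2 / beta) by ring.
  have fin : (\int[mu]_(t in `[0%R, z]) (t `^ (- (2 / beta)) * expR (- t))%:E)%E
      \is a fin_num.
    apply: integral_powR_expRN_fin => //.
    by rewrite ltrN2 ltr_pdivrMr ?mul1r// (lt_trans _ beta2).
  rewrite /lower_incomplete_gamma /Rintegral alphaE fineK//.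
  rewrite -integral_itv_obnd_cbnd; last first.
    apply/measurable_EFinP; apply: measurable_funM; last exact: measurable_expRN.
    by apply: measurable_funTS; exact: measurable_powR.
  rewrite -ge0_integralZl; first last.
  - by rewrite lee_fin mulr_ge0// powR_ge0.
  - by move=> t _; rewrite lee_fin mulr_ge0 ?powR_ge0 ?expR_ge0.
  - apply/measurable_EFinP; apply: measurable_funM; last exact: measurable_expRN.
    by apply: measurable_funTS; exact: measurable_powR.
  - exact: measurable_itv.
  apply: eq_integral => t; rewrite inE/= in_itv/= => /andP[_ tz].
  by rewrite /k tz -EFinM; congr EFin; ring.
rewrite -!EFinM -EFinD -/c; congr EFin.
by rewrite /varphi; ring.
Qed.

Context d (T : measurableType d) (P : probability T R) (S : {RV P >-> R}).
Hypothesis S0 : forall w, 0 < S w.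
Hypothesis finS : ('E_P[fun w => (S w `^ (2 / beta))%R] < +oo)%E.

Lemma integral_expectation_loss (s z : R) : 0 < s -> 0 <= z ->
  (\int[plane]_x \int[P]_w (1 - loss_weight s (z * s) (loss x (S w)))%:E =
   (pi / K ^+ 2 * fine 'E_P[fun w => (S w `^ (2 / beta))%R] *
    s `^ (2 / beta) * varphi beta z)%:E)%E.
Proof.
move=> s0 z0; have u0 : 0 <= z * s by rewrite mulr_ge0// ltW.
pose h (y : (R * R) * T) := (1 - loss_weight s (z * s) (loss y.1 (S y.2)))%:E.
have h0 y : (0 <= h y)%E.
  by rewrite lee_fin subr_ge0; case/andP: (loss_weight01 (loss y.1 (S y.2)) s0 u0).
have mh : measurable_fun setT h.
  apply/measurable_EFinP; apply: measurable_funB => //.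
  apply: (measurableT_comp (measurable_loss_weight s (z * s))).
  have mS := measurableT_comp (measurable_funP S) (@measurable_snd _ _ (R * R)%type T).
  exact: (measurableT_comp measurable_loss
    (measurable_fun_pair (@measurable_fst _ _ (R * R)%type T) mS)).
transitivity (\int[P]_w \int[plane]_x h (x, w))%E.
  exact: (@fubini_tonelli _ _ _ _ R plane P h mh h0).
pose c := pi / K ^+ 2 * s `^ (2 / beta) * varphi beta z.
have mSd : measurable_fun setT (fun w => S w `^ (2 / beta)).
  exact: (measurableT_comp (measurable_powR (2 / beta)) (measurable_funP S)).
have hc w : (\int[plane]_x h (x, w) = c%:E * (S w `^ (2 / beta))%:E)%E.
  rewrite /h/= integral_loss// -EFinM /c; congr EFin; ring.
have S1 : (\int[P]_w (S w `^ (2 / beta))%:E)%E \is a fin_num.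
  move: finS; rewrite unlock => finS'; rewrite ge0_fin_numE// integral_ge0// => w _.
  by rewrite lee_fin powR_ge0.
(* The sign is read off the nonnegative inner integral at one outcome, the power of [S] there being
   positive. *)
have c0 : 0 <= c.
  have S0' : (0 <= \int[plane]_x h (x, point))%E by exact: integral_ge0.
  move: S0'; rewrite hc -EFinM lee_fin pmulr_lge0// powR_gt0//.
under eq_integral do rewrite hc.
rewrite ge0_integralZl; first last.
- by rewrite lee_fin.
- by move=> w _; rewrite lee_fin powR_ge0.
- exact/measurable_EFinP.
- exact: measurableT.
rewrite unlock -[X in (_ * X)%E]fineK// -EFinM /c; congr EFin; ring.
Qed.

End loss.

(** * Bounds and increments of [varphi] *)

Section varphi.
Context {R : realType}.
Variable beta : R.
Hypothesis beta2 : 2 < beta.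
Local Notation plane := (@plane_measure R).
Local Notation del := (2 / beta).

Let beta0 : 0 < beta. Proof. exact: lt_trans beta2. Qed.

Lemma varphi0 : varphi beta 0 = 1.
Proof.
rewrite /varphi powR0 ?mul0r ?addr0 ?oppr0 ?expR0//.
by rewrite mulf_neq0// ?invr_eq0 gt_eqF.
Qed.

Let w0 v t x : 0 < t -> 0 <= v ->
  (0 <= (1 - loss_weight t v (loss 1 beta x 1))%:E)%E.
Proof.
move=> t0 v0; rewrite lee_fin subr_ge0.
by case/andP: (loss_weight01 (loss 1 beta x 1) t0 v0).
Qed.

Let mw v t :
  measurable_fun setT (fun x => (1 - loss_weight t v (loss 1 beta x 1))%:E).
Proof.
apply/measurable_EFinP; apply: measurable_funB => //.
exact: (measurableT_comp (measurable_loss_weight t v) (measurable_loss1 1 beta 1)).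
Qed.

(* [varphi] is thus an integral over the plane, so that inequalities between
   weights transfer to [varphi]. *)
Let int_w v t : 0 < t -> 0 <= v ->
  (\int[plane]_x (1 - loss_weight t v (loss 1 beta x 1))%:E =
   (pi * (varphi beta (v / t) * t `^ del))%:E)%E.
Proof.
move=> t0 v0.
have := @integral_loss R 1 beta ltr01 beta2 1 t (v / t) ltr01 t0.
rewrite divfK ?gt_eqF// => ->; last by rewrite divr_ge0// ltW.
by rewrite powR1 expr1n divr1 mulr1; congr EFin; ring.
Qed.

Lemma varphi_ge1 z : 0 <= z -> 1 <= varphi beta z.
Proof.
move=> z0.
have : (\int[plane]_x (1 - loss_weight 1 0 (loss 1 beta x 1))%:E <=
    \int[plane]_x (1 - loss_weight 1 z (loss 1 beta x 1))%:E)%E.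
  apply: ge0_le_integral.
  - exact: measurableT.
  - by move=> x _; exact: w0.
  - exact: mw.
  - exact: mw.
  - move=> x _; rewrite lee_fin lerD2l lerN2 /loss_weight.
    case: ifPn => // l1; rewrite mul0r oppr0 ler_expR oppr_le0 divr_ge0//.
    exact: le_trans l1.
by rewrite !int_w// lee_fin ler_pM2l ?pi_gt0// powR1 !mulr1 mul0r divr1 varphi0.
Qed.

(** The terms with [u = 0] represent the pure powers, since [varphi] is 1 at 0. Differences are
    moved across the inequality so that only nonnegative integrands occur and monotonicity of the
    integral suffices. *)
Let le_varphi (s s' s1 s1' u c : R) :
  0 < s -> 0 < s' -> 0 < s1 -> 0 < s1' -> 0 <= u -> 0 <= c ->
  (forall t, 0 <= t ->
    (1 - loss_weight s u t) + c * (1 - loss_weight s1 0 t) <=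
    (1 - loss_weight s' u t) + c * (1 - loss_weight s1' 0 t)) ->
  varphi beta (u / s) * s `^ del + c * s1 `^ del <=
  varphi beta (u / s') * s' `^ del + c * s1' `^ del.
Proof.
move=> s0 s'0 s10 s1'0 u0 c0 le_w.
have int_wD (t t1 : R) : 0 < t -> 0 < t1 ->
    (\int[plane]_x ((1 - loss_weight t u (loss 1 beta x 1))%:E +
      c%:E * (1 - loss_weight t1 0 (loss 1 beta x 1))%:E) =
    (pi * (varphi beta (u / t) * t `^ del + c * t1 `^ del))%:E)%E.
  move=> t0 t10; rewrite ge0_integralD.
  - rewrite int_w// ge0_integralZl.
    + by rewrite int_w// mul0r varphi0 mul1r -EFinM -EFinD; congr EFin; ring.
    + exact: measurableT.
    + exact: mw.
    + by move=> x _; exact: w0.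
    + by rewrite lee_fin.
  - exact: measurableT.
  - by move=> x _; exact: w0.
  - exact: mw.
  - by move=> x _; rewrite mule_ge0 ?lee_fin// -lee_fin w0.
  - by apply: emeasurable_funM => //; exact: mw.
rewrite -(@ler_pM2l _ pi) ?pi_gt0// -lee_fin -!int_wD//.
apply: ge0_le_integral.
- exact: measurableT.
- by move=> x _; rewrite adde_ge0 ?w0// mule_ge0 ?w0// lee_fin.
- by apply: emeasurable_funD; [exact: mw|apply: emeasurable_funM => //; exact: mw].
- by apply: emeasurable_funD; [exact: mw|apply: emeasurable_funM => //; exact: mw].
- move=> x _; rewrite -!EFinM -!EFinD lee_fin; apply: le_w.
  by apply: loss_ge0; exact: ler01.
Qed.

(** Raising the cutoff from [s] to [s'] changes the weight only at losses t in [s, s'[, from exp (-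
    u / t) to 0. Bounding exp (- u / t) by its value at [s'], or below by its value at [s] in the
    companion lemma, leaves the increment of the pure power. *)
Lemma varphi_increment_le (s s' u : R) : 0 < s -> s <= s' -> 0 <= u ->
  varphi beta (u / s') * s' `^ del - varphi beta (u / s) * s `^ del <=
  expR (- (u / s')) * (s' `^ del - s `^ del).
Proof.
move=> s0 ss' u0; have s'0 : 0 < s' by exact: lt_le_trans ss'.
suff : varphi beta (u / s') * s' `^ del + expR (- (u / s')) * s `^ del <=
    varphi beta (u / s) * s `^ del + expR (- (u / s')) * s' `^ del by lra.
apply: le_varphi => // t t0.
rewrite /loss_weight !mul0r !oppr0 expR0.
have [s't|ts'] := leP s' t.
  by rewrite (le_trans ss' s't).
have [st|ts] := leP s t; last by lra.
have t00 : 0 < t by exact: lt_le_trans st.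
have : expR (- (u / t)) <= expR (- (u / s')).
  by rewrite ler_expR lerN2 ler_wpM2l// lef_pV2 ?posrE// ltW.
by lra.
Qed.

Lemma varphi_increment_ge (s s' u : R) : 0 < s -> s <= s' -> 0 <= u ->
  expR (- (u / s)) * (s' `^ del - s `^ del) <=
  varphi beta (u / s') * s' `^ del - varphi beta (u / s) * s `^ del.
Proof.
move=> s0 ss' u0; have s'0 : 0 < s' by exact: lt_le_trans ss'.
suff : varphi beta (u / s) * s `^ del + expR (- (u / s)) * s' `^ del <=
    varphi beta (u / s') * s' `^ del + expR (- (u / s)) * s `^ del by lra.
apply: le_varphi => // t t0.
rewrite /loss_weight !mul0r !oppr0 expR0.
have [s't|ts'] := leP s' t.
  by rewrite (le_trans ss' s't).
have [st|ts] := leP s t; last by lra.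
have : expR (- (u / s)) <= expR (- (u / t)).
  rewrite ler_expR lerN2 ler_wpM2l// lef_pV2 ?posrE//.
  by exact: lt_le_trans st.
by lra.
Qed.

End varphi.

(** * The tail Laplace transform *)

(** [er_map] fixes -oo, where the exponential is 0; the maximum with 0 corrects this value. *)
Lemma measurable_expeR {R : realType} : measurable_fun setT (@expeR R).
Proof.
rewrite (_ : expeR = fun x => Order.max 0%E (er_map expR x)).
  apply: measurable_maxe; first exact: measurable_cst.
  exact: (@measurable_er_map _ R R expR (@measurable_expR R)).
apply/funext => -[r| |] /=.
- by rewrite max_r// lee_fin expR_ge0.
- by rewrite max_r// leey.
- by rewrite max_l// leNye.
Qed.

Section laplace_kernel.
Local Open Scope ereal_scope.
Context {R : realType}.

(** At [x = +oo] the value is 0 if [u > 0], but 1 if [u = 0], because 0 times +oo is 0; so [u = 0]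
    recovers plain probabilities even where the sum of inverse losses diverges. *)
Definition laplace_kernel (u : R) (x : \bar R) : R := fine (expeR (- (u%:E * x))).

Lemma laplace_kernel01 u x : (0 <= u)%R -> 0 <= x ->
  (0 <= laplace_kernel u x <= 1)%R.
Proof.
move=> u0 x0; have : 0 <= u%:E * x by rewrite mule_ge0// lee_fin.
rewrite /laplace_kernel; case: (_ * _) => [r| |]//= r0; last by rewrite lexx ler01.
by rewrite expR_ge0/= -expR0 ler_expR oppr_le0.
Qed.

Lemma laplace_kernel_anti u v x : (0 <= u)%R -> (u <= v)%R -> 0 <= x ->
  (laplace_kernel v x <= laplace_kernel u x)%R.
Proof.
move=> u0 uv x0.
have fin y : 0 <= y -> expeR (- y) \is a fin_num by case: y.
apply: fine_le.
- by apply: fin; rewrite mule_ge0// lee_fin (le_trans u0).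
- by apply: fin; rewrite mule_ge0// lee_fin.
- by rewrite lee_expeR leeN2 lee_wpmul2r// lee_fin.
Qed.

Lemma laplace_kernel0 x : laplace_kernel 0 x = 1%R.
Proof. by rewrite /laplace_kernel mul0e oppe0 /= expR0. Qed.

Lemma measurable_laplace_kernel u : measurable_fun setT (laplace_kernel u).
Proof.
apply: measurableT_comp => //; apply: (measurableT_comp measurable_expeR).
apply: (measurableT_comp (@oppe_measurable R setT)).
exact: emeasurable_funM.
Qed.

End laplace_kernel.

Section infinite_product.
Context {R : realType}.

Lemma le_inf_range (l : nat -> R) s : (forall i, 0 <= l i) ->
  (s <= inf (range l)) = `[< forall i, s <= l i >].
Proof.
move=> l0; have l_lb : has_lbound (range l) by exists 0 => _ [i _ <-].
apply/idP/asboolP => [sl i|sl].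
  by apply: (le_trans sl); apply: ge_inf => //; exists i.
by apply: lb_le_inf; [exists (l 0%N); exists 0%N|move=> _ [i _ <-]].
Qed.

Variables (l : nat -> R) (s u : R).
Hypotheses (s0 : 0 < s) (u0 : 0 <= u) (l0 : forall i, 0 <= l i).

Let I := (\sum_(i <oo) ((l i)%:E)^-1)%E.

(** One loss below [s] puts a factor 0 in all later products; otherwise the exponents add up to
    partial sums of the inverse losses. *)
Lemma cvg_prod_loss_weight :
  \prod_(i < m) loss_weight s u (l i) @[m --> \oo] -->
  (if s <= inf (range l) then laplace_kernel u I else 0).
Proof.
rewrite le_inf_range//; case: asboolP => [sl|/existsNP[i /negP]]; last first.
  rewrite -ltNge => lis; apply: cvg_near_cst; exists i.+1 => // m /= im.
  by rewrite (bigD1 (Ordinal im))//= {1}/loss_weight leNgt lis/= mul0r.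
have li0 i : 0 < l i by exact: lt_le_trans (sl i).
pose sg m := \sum_(i < m) (l i)^-1.
have -> : (fun m => \prod_(i < m) loss_weight s u (l i)) =
    (fun m => expR (- (u * sg m))).
  apply/funext => m; rewrite /sg mulr_sumr -sumrN expR_sum.
  by apply: eq_bigr => i _; rewrite /loss_weight sl.
have I0 : (0 <= I)%E.
  by apply: nneseries_ge0 => i _ _; rewrite inve_ge0 lee_fin.
have cvgI : (sg m)%:E @[m --> \oo] --> I.
  rewrite [X in X @ _](_ : _ = fun m => (\sum_(0 <= i < m) ((l i)%:E)^-1)%E).
    by apply: is_cvg_nneseries => i _ _; rewrite inve_ge0 lee_fin.
  apply/funext => m; rewrite big_mkord /sg -sumEFin; apply: eq_bigr => i _.
  by rewrite inver gt_eqF.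
rewrite /laplace_kernel; move: I0 cvgI; case: I => [r| |]//= _ cvgI.
- apply: (@cvg_comp _ _ _ _ expR); last exact: continuous_expR.
  apply: cvgN; apply: cvgM; first exact: cvg_cst.
  exact: fine_cvg cvgI.
(* For a divergent sum the products tend to 0, except at [u = 0], where they are constantly 1, in
   agreement with the kernel. *)
- move: u0; rewrite le_eqVlt => /predU1P[<-|upos].
    rewrite mul0e oppe0 /= expR0.
    by under eq_cvg do rewrite mul0r oppr0 expR0; exact: cvg_cst.
  rewrite gt0_muley ?lte_fin//=.
  have sgy : sg m @[m --> \oo] --> +oo%R by exact/cvgeryP.
  have usgy : u * sg m @[m --> \oo] --> +oo%R.
    apply/cvgryPge => A; move/cvgryPge : sgy => /(_ (A / u)).
    by apply: filterS => m; rewrite ler_pdivrMr// mulrC.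
  exact: (cvg_comp _ _ usgy (@cvgr_expR R)).
Qed.

End infinite_product.

(** * Joint transform of the path loss and the inverse losses *)

Section network.
Local Open Scope ereal_scope.
Context (R : realType) (d : measure_display) (T : measurableType d).
Variables (P : probability T R) (lambda K beta : R).
Variables (X : nat -> {RV P >-> (R * R)%type}) (Ss : nat -> {RV P >-> R}).
Variable S : {RV P >-> R}.
Hypotheses (lambda0 : (0 < lambda)%R) (K0 : (0 < K)%R) (beta2 : (2 < beta)%R).
Hypothesis poissonX : homogeneous_poisson_process P lambda X.
Hypothesis S0 : forall w, (0 < S w)%R.
Hypothesis Ss0 : forall i w, (0 < Ss i w)%R.
Hypothesis lawS : forall i (B : set R), measurable B ->
  distribution P (Ss i) B = distribution P S B.
Hypothesis indS : mutually_independent P Ss.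
Hypothesis indXS : independent_families P X Ss.
Hypothesis finS : 'E_P[fun w => (S w `^ (2 / beta))%R] < +oo.
Local Notation del := (2 / beta)%R.
Local Notation plane := (@plane_measure R).

Let a := (lambda * pi * fine 'E_P[fun w => (S w `^ del)%R] / K ^+ 2)%R.
Let ell := propagation_loss K beta X Ss.
Let L := path_loss_factor K beta X Ss.

(** Taking [u = z * s] makes the mean integral a product of s^(2/beta) and [varphi beta z]. Marking
    replaces each weight by its mean [p] over the shadowing, and the Laplace functional is applied
    to [p]. *)
Lemma propagation_loss_functional (s z : R) : (0 < s)%R -> (0 <= z)%R ->
  (\int[P]_w (\prod_(i < m) loss_weight s (z * s) (ell i w))%:E)
    @[m --> \oo] --> (expR (- a * (varphi beta z * s `^ del)))%:E.
Proof.
move=> s0 z0; have u0 : (0 <= z * s)%R by rewrite mulr_ge0// ltW.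
pose r (y : (R * R) * R) := loss_weight s (z * s) (loss K beta y.1 y.2).
have mr : measurable_fun setT r.
  exact: (measurableT_comp (measurable_loss_weight s (z * s)) (measurable_loss K beta)).
have r01 y : (0 <= r y <= 1)%R by exact: loss_weight01.
have intr1 x : \int[distribution P S]_t (r (x, t))%:E =
    \int[P]_w (loss_weight s (z * s) (loss K beta x (S w)))%:E.
  rewrite ge0_integral_distribution//.
    apply/measurable_EFinP.
    exact: (measurableT_comp mr (measurable_fun_pair (measurable_cst x) (@measurable_id _ R _))).
  by move=> t; rewrite lee_fin; case/andP: (r01 (x, t)).
have mw x : measurable_fun setT (fun w => loss_weight s (z * s) (loss K beta x (S w))).
  exact: (measurableT_comp mr (measurable_fun_pair (measurable_cst x) (measurable_funP S))).
have w01 x w : (0 <= loss_weight s (z * s) (loss K beta x (S w)) <= 1)%R.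
  exact: loss_weight01.
pose p x := fine (\int[distribution P S]_t (r (x, t))%:E).
have int1 : \int[P]_w (1 : \bar R) = 1.
  by rewrite integral_cst// mul1e; exact: probability_setT.
have pE x : \int[distribution P S]_t (r (x, t))%:E = (p x)%:E.
  rewrite /p fineK// intr1 ge0_fin_numE; last first.
    by apply: integral_ge0 => w _; rewrite lee_fin; case/andP: (w01 x w).
  apply: (@le_lt_trans _ _ (\int[P]_w (1 : \bar R))); last by rewrite int1 ltry.
  apply: ge0_le_integral => //.
  - by move=> w _; rewrite lee_fin; case/andP: (w01 x w).
  - exact/measurable_EFinP.
  - by move=> w _; rewrite lee_fin; case/andP: (w01 x w).
(* The Laplace functional integrates 1 - p over the plane, so the complement is rewritten as a mean
   of nonnegative terms, to which Fubini applies. *)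
have onem_pE x : (1 - p x)%:E =
    \int[P]_w (1 - loss_weight s (z * s) (loss K beta x (S w)))%:E.
  rewrite EFinB -pE intr1 -[X in X - _]int1.
  rewrite -[in X in X - _](_ : \int[P]_w ((1 - loss_weight s (z * s) (loss K beta x (S w)))%:E +
    (loss_weight s (z * s) (loss K beta x (S w)))%:E) = \int[P]_w 1); last first.
    by apply: eq_integral => w _; rewrite -EFinD subrK.
  rewrite ge0_integralD//.
  - by rewrite addeK// -intr1 pE.
  - by move=> w _; rewrite lee_fin subr_ge0; case/andP: (w01 x w).
  - by apply/measurable_EFinP; exact: measurable_funB.
  - by move=> w _; rewrite lee_fin; case/andP: (w01 x w).
  - exact/measurable_EFinP.
have p01 x : (0 <= p x <= 1)%R.
  apply/andP; split.
    rewrite -lee_fin -pE; apply: integral_ge0 => t _.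
    by rewrite lee_fin; case/andP: (r01 (x, t)).
  rewrite -subr_ge0 -lee_fin onem_pE; apply: integral_ge0 => w _.
  by rewrite lee_fin subr_ge0; case/andP: (w01 x w).
have mp : measurable_fun setT p.
  apply: measurableT_comp => //.
  apply: (@measurable_fun_fubini_tonelli_F _ _ _ _ R (distribution P S) (EFin \o r)).
    exact/measurable_EFinP.
  by move=> y; rewrite lee_fin; case/andP: (r01 y).
have intp : \int[plane]_x (1 - p x)%:E =
    (pi / K ^+ 2 * fine 'E_P[fun w => (S w `^ del)%R] * s `^ del * varphi beta z)%:E.
  under eq_integral do rewrite onem_pE.
  exact: integral_expectation_loss.
have markE m : \int[P]_w (\prod_(i < m) loss_weight s (z * s) (ell i w))%:E =
    \int[P]_w (\prod_(i < m) p (X i w))%:E.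
  exact: (@marking _ T R P _ (R * R)%type _ R X Ss (distribution P S) lawS indS indXS
    (fun=> r) (fun=> p) (fun=> mr) (fun=> r01) (fun=> mp) (fun=> p01) (fun=> pE)).
under eq_cvg do rewrite markE.
have -> : (- a * (varphi beta z * s `^ del) =
    - (lambda * fine (\int[plane]_x (1 - p x)%:E)))%R.
  by rewrite intp /= /a; ring.
have intp_fin : \int[plane]_x (1 - p x)%:E < +oo by rewrite intp ltry.
have mX i : measurable_fun setT (X i) by exact: measurable_funP.
exact: (@poisson_laplace _ T R P _ (measurableTypeR R * measurableTypeR R)%type
  plane lambda X mX (ltW lambda0) poissonX p mp p01 intp_fin).
Qed.

Let ell0 i w : (0 <= ell i w)%R.
Proof. by rewrite /ell /propagation_loss divr_ge0 ?powR_ge0// ltW. Qed.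

Let mell i : measurable_fun setT (ell i).
Proof.
exact: (measurableT_comp (measurable_loss K beta)
  (measurable_fun_pair (measurable_funP (X i)) (measurable_funP (Ss i)))).
Qed.

Lemma path_loss_factor_ge0 w : (0 <= L w)%R.
Proof.
by rewrite /L /path_loss_factor le_inf_range//; apply/asboolP => i; exact: ell0.
Qed.

Lemma measurable_path_loss_factor : measurable_fun setT L.
Proof.
have -> : L = (fun w => infs (ell ^~ w) 0%N).
  apply/funext => w; rewrite /infs/= /L /path_loss_factor; congr inf.
  by apply/seteqP; split => [_ [i _ <-]|_ [i _ <-]]; exists i.
apply: measurable_fun_infs => // w _.
by exists 0%R => _ [i _ <-]; exact: ell0.
Qed.

Definition inverse_loss_sum w : \bar R := \sum_(i <oo) ((ell i w)%:E)^-1.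

Lemma inverse_loss_sum_ge0 w : 0 <= inverse_loss_sum w.
Proof. by apply: nneseries_ge0 => i _ _; rewrite inve_ge0 lee_fin. Qed.

Lemma measurable_inverse_loss_sum : measurable_fun setT inverse_loss_sum.
Proof.
apply: ge0_emeasurable_sum => [i w _ _|i _]; first by rewrite inve_ge0 lee_fin.
(* The extended inverse of 0 is +oo, whereas the inverse of 0 in [R] is 0. *)
rewrite (_ : (fun w => _) = fun w => if ell i w == 0%R then +oo else ((ell i w)^-1)%:E).
  apply: measurable_fun_ifT => //; first exact: measurable_fun_eqr.
  apply/measurable_EFinP; exact: (measurableT_comp (@measurable_invr R)).
by apply/funext => w; rewrite inver.
Qed.

(** The expected finite products have two limits: one by dominated convergence, since they converge
    pointwise, and one by the Poisson computation. *)
Lemma laplace_tail (s z : R) : (0 < s)%R -> (0 <= z)%R ->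
  \int[P]_(w in [set w | (s <= L w)%R]) (laplace_kernel (z * s) (inverse_loss_sum w))%:E =
  (expR (- a * (varphi beta z * s `^ del)))%:E.
Proof.
move=> s0 z0; have u0 : (0 <= z * s)%R by rewrite mulr_ge0// ltW.
have w01 m w : (0 <= \prod_(i < m) loss_weight s (z * s) (ell i w) <= 1)%R.
  apply/andP; split.
    by apply: prodr_ge0 => i _; case/andP: (loss_weight01 (ell i w) s0 u0).
  by apply: prodr_ile1 => i _; exact: loss_weight01.
pose g w := (if (s <= L w)%R then laplace_kernel (z * s) (inverse_loss_sum w) else 0)%R.
have mg : measurable_fun setT g.
  apply: measurable_fun_ifT => //.
    by apply: measurable_fun_ler => //; exact: measurable_path_loss_factor.
  exact: (measurableT_comp (measurable_laplace_kernel (z * s))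
    measurable_inverse_loss_sum).
have cvgF := propagation_loss_functional s0 z0.
have mweight m : measurable_fun setT
    (fun w => (\prod_(i < m) loss_weight s (z * s) (ell i w))%R).
  apply: measurable_prod => i _.
  exact: (measurableT_comp (measurable_loss_weight s (z * s)) (mell i)).
have cvgG : (\int[P]_w (\prod_(i < m) loss_weight s (z * s) (ell i w))%:E)
    @[m --> \oo] --> \int[P]_w (g w)%:E.
  have [] := @dominated_convergence _ _ _ P setT measurableT
    (fun m w => (\prod_(i < m) loss_weight s (z * s) (ell i w))%:E)
    (fun w => (g w)%:E) (cst 1) => //.
  - by move=> m; exact/measurable_EFinP.
  - exact/measurable_EFinP.
  - apply: aeW => w _; apply: cvg_EFin; first exact: nearW.
    exact: (cvg_prod_loss_weight s0 u0 (ell0 ^~ w)).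
  - by apply: finite_measure_integrable_cst.
  - apply: aeW => w m _ /=; rewrite lee_fin ger0_norm; by case/andP: (w01 m w).
rewrite -(cvg_unique _ cvgG cvgF)//.
rewrite integral_mkcond; apply: eq_integral => w _.
rewrite patchE /g; case: (leP s (L w)) => sL; first by rewrite mem_set.
by rewrite memNset//= leNgt sL.
Qed.

End network.

(** * Conditioning on the path-loss factor *)

Section increments.
Context {R : realType}.

(** The difference quotient of [psi] is squeezed by that of [X], which converges, times a factor
    tending to 0; so [psi] has derivative 0 everywhere. *)
Lemma cst_of_small_increments (psi X : R -> R) (eps : R -> R -> R) :
  (forall y y', `|psi y' - psi y| <= `|X y' - X y| * eps y y') ->
  (forall y, derivable X y 1) -> (forall y, eps y y' @[y' --> y] --> 0) ->
  forall y y', psi y = psi y'.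
Proof.
move=> psiX dX eps0 y y'; apply: is_derive_0_is_cst => {y'} {}y.
have cvgq : h^-1 *: (psi (h *: 1 + y) - psi y) @[h --> 0^'] --> (0 : R).
  apply/norm_cvg0P.
  have cvgX : `|h^-1 *: (X (h *: 1 + y) - X y)| * eps y (h *: 1 + y) @[h --> 0^'] --> (0 : R).
    rewrite -[X in _ --> X](mulr0 `|'D_1 X y|); apply: cvgM.
      by apply: cvg_norm; exact: dX.
    apply: (@cvg_comp _ _ _ (fun h : R => h *: 1 + y) (eps y)); last exact: eps0.
    apply: cvg_within_filter; under eq_cvg do rewrite [_ *: _]mulr1.
    have : (fun h : R => h + y) h @[h --> (0 : R)] --> 0 + y.
      by apply: cvgD; [exact: cvg_id|exact: cvg_cst].
    by rewrite add0r.
  apply: squeeze_cvgr cvgX; last exact: cvg_cst.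
  near=> h; rewrite normr_ge0/= !normrM -mulrA ler_wpM2l//.
split; first exact: cvgP cvgq.
exact: cvg_lim cvgq.
Unshelve. all: by end_near. Qed.

Lemma norm_sub_incr (f f' h h' lo hi : R) :
  lo <= f - f' -> f - f' <= hi -> lo <= h - h' -> h - h' <= hi ->
  `|(f' - h') - (f - h)| <= hi - lo.
Proof. by move=> *; rewrite ler_norml; apply/andP; split; lra. Qed.

Lemma norm_sub_le (f h u v : R) :
  0 <= f -> f <= u -> 0 <= h -> h <= v -> `|f - h| <= u + v.
Proof. by move=> *; rewrite ler_norml; apply/andP; split; lra. Qed.

End increments.

(** * From the tail identity to the conditional expectation *)

Section conditional_laplace.
Context d (T : measurableType d) (R : realType) (P : probability T R).
Variables (L : T -> R) (I : T -> \bar R) (a beta : R).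
Hypotheses (mL : measurable_fun setT L) (L0 : forall w, 0 <= L w).
Hypotheses (mI : measurable_fun setT I) (I0 : forall w, (0 <= I w)%E).
Hypotheses (a0 : 0 <= a) (beta2 : 2 < beta).
Local Notation del := (2 / beta).
Hypothesis tail : forall s z, 0 < s -> 0 <= z ->
  (\int[P]_(w in [set w | (s <= L w)%R]) (laplace_kernel (z * s) (I w))%:E =
   (expR (- a * (varphi beta z * s `^ del)))%:E)%E.
Variable z : R.
Hypothesis z0 : 0 <= z.

Let phi := varphi beta z.
(** The cumulative hazard of [L]: for [s > 0], the event [tl s] has probability exp (- x s). *)
Let x s := a * s `^ del.
Let Y w := fine (expeR (- (z%:E * ((L w)%:E * I w - 1)))%E).
Let g s := expR (- a * (phi - 1) * s `^ del).
Let tl s := [set w | s <= L w].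
Let band s s' := [set w | s <= L w < s'].

Let del0 : 0 < del.
Proof. by rewrite divr_gt0// (lt_trans _ beta2). Qed.

Let phi1 : 1 <= phi. Proof. exact: varphi_ge1. Qed.

Let mtl s : measurable (tl s).
Proof.
rewrite (_ : tl s = (fun w => s <= L w) @^-1` [set true])//.
by rewrite -[X in measurable X]setTI; apply: measurable_fun_ler.
Qed.

Let mband s s' : measurable (band s s').
Proof.
rewrite (_ : band s s' = tl s `\` tl s'); first exact: measurableD.
apply/seteqP; split => w /=; rewrite /band /tl/=.
  by move=> /andP[-> ws]; split=> //; apply/negP; rewrite -ltNge.
by move=> [-> /negP]; rewrite -ltNge.
Qed.

Let bounded_integrable (f : T -> R) M A : measurable A -> measurable_fun setT f ->
  (forall w, 0 <= f w <= M) -> P.-integrable A (EFin \o f).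
Proof.
move=> mA mf fM; apply: (@le_integrable _ _ _ P A mA _ (EFin \o cst M)).
- by apply/measurable_EFinP; exact: measurable_funTS.
- move=> w _ /=; have /andP[f0 fM'] := fM w.
  by rewrite lee_fin !ger0_norm// (le_trans f0).
- exact: finite_measure_integrable_cst.
Qed.

Let tl_band (f : T -> R) (M s s' : R) : s <= s' -> measurable_fun setT f ->
  (forall w, 0 <= f w <= M) ->
  \int[P]_(w in tl s) f w - \int[P]_(w in tl s') f w = \int[P]_(w in band s s') f w.
Proof.
move=> ss' mf fM.
have tlE : tl s = band s s' `|` tl s'.
  apply/seteqP; split => w /=; rewrite /tl /band/=.
    by move=> sw; case: (ltP (L w) s') => ws; [left; rewrite sw|right].
  by move=> [/andP[]//|]; exact: le_trans.
rewrite tlE Rintegral_setU ?addrK//.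
- by rewrite -tlE; exact: bounded_integrable fM.
- rewrite disj_set2E; apply/eqP/seteqP; split => // w [/= /andP[_]].
  by rewrite ltNge => /negP.
Qed.

Let k u w := laplace_kernel u (I w).

Let k01 u w : 0 <= u -> 0 <= k u w <= 1.
Proof. by move=> u0; exact: laplace_kernel01. Qed.

Let mk u : measurable_fun setT (k u).
Proof. exact: (measurableT_comp (measurable_laplace_kernel u) mI). Qed.

(** Reparametrised so that [u] stays fixed while [s] varies, which lets two tails be subtracted over
    a band. *)
Let tail_k (u s : R) : 0 < s -> 0 <= u ->
  \int[P]_(w in tl s) k u w = expR (- a * (varphi beta (u / s) * s `^ del)).
Proof.
move=> s0 u0; have us0 : 0 <= u / s by rewrite divr_ge0// ltW.
by have := tail s0 us0; rewrite divfK ?gt_eqF// => tailE; rewrite /Rintegral tailE.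
Qed.

Let tail_P s : 0 < s -> fine (P (tl s)) = expR (- x s).
Proof.
move=> s0; have := tail_k s0 (lexx 0).
rewrite mul0r varphi0// mul1r mulNr -/(x s) => <-.
under eq_Rintegral do rewrite /k laplace_kernel0.
by rewrite Rintegral_cst// mul1r.
Qed.

Let powR_del_le s s' : 0 < s -> s <= s' -> s `^ del <= s' `^ del.
Proof.
move=> s0 ss'; apply: ge0_ler_powR; rewrite ?nnegrE ?(ltW del0) ?(ltW s0)//.
exact: le_trans (ltW s0) ss'.
Qed.

Let x_le s s' : 0 < s -> s <= s' -> x s <= x s'.
Proof.
by move=> s0 ss'; rewrite ler_wpM2l// powR_del_le.
Qed.

Let Y_pos w : 0 < L w -> Y w = expR z * k (z * L w) w.
Proof.
move=> Lw; rewrite /Y /k /laplace_kernel.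
case: (I w) (I0 w) => [r| |]//= r0.
  by rewrite -expRD; congr expR; ring.
rewrite gt0_muley ?lte_fin//=.
move: z0; rewrite le_eqVlt => /predU1P[<-|zpos].
  by rewrite !mul0e mul0r mul0e oppe0/= expR0 mul1r.
by rewrite !gt0_muley ?lte_fin ?mulr_gt0//= mulr0.
Qed.

Let Y_bound w : 0 <= Y w <= expR z.
Proof.
rewrite /Y.
have h : (0 <= z%:E * ((L w)%:E * I w))%E by rewrite mule_ge0 ?lee_fin// mule_ge0 ?lee_fin.
case: (I w) (I0 w) h => [r| |]//= r0 h.
  rewrite expR_ge0/= ler_expR; move: h; rewrite -!EFinM lee_fin; lra.
have := L0 w; rewrite le_eqVlt => /predU1P[Lw|Lw].
  by rewrite -Lw mul0e add0e /= expR_ge0/= ler_expR; lra.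
rewrite gt0_muley ?lte_fin//=.
move: z0; rewrite le_eqVlt => /predU1P[<-|zpos].
  by rewrite mul0e oppe0/= expR0 ler01 lexx.
by rewrite gt0_muley ?lte_fin//= lexx expR_ge0.
Qed.

Let mY : measurable_fun setT Y.
Proof.
apply: measurableT_comp => //; apply: (measurableT_comp measurable_expeR).
apply: (measurableT_comp (@oppe_measurable R setT)).
apply: emeasurable_funM => //; apply: emeasurable_funB => //.
by apply: emeasurable_funM => //; exact/measurable_EFinP.
Qed.

Let g01 s : 0 <= g s <= 1.
Proof.
rewrite expR_ge0/= -expR0 ler_expR mulNr mulNr oppr_le0 mulr_ge0 ?powR_ge0//.
by rewrite mulr_ge0// subr_ge0.
Qed.

Let mg : measurable_fun setT g.
Proof.
apply: (measurableT_comp (@measurable_expR R)); apply: measurable_funM => //.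
Qed.

Let gL01 w : 0 <= g (L w) <= 1. Proof. exact: g01. Qed.

Let mgL : measurable_fun setT (g \o L). Proof. exact: measurableT_comp. Qed.

Let F s := \int[P]_(w in tl s) Y w.
Let H s := \int[P]_(w in tl s) g (L w).

Let expB_le (u v : R) : u <= v -> expR (- u) - expR (- v) <= expR (- u) * (v - u).
Proof.
move=> uv; have -> : expR (- v) = expR (- u) * expR (- (v - u)).
  by rewrite -expRD; congr expR; ring.
have := ler_wpM2l (expR_ge0 (- u)) (expR_ge1Dx (- (v - u))); lra.
Qed.

Let expB_ge (u v : R) : u <= v -> expR (- v) * (v - u) <= expR (- u) - expR (- v).
Proof.
move=> uv; have -> : expR (- u) = expR (- v) * expR (v - u).
  by rewrite -expRD; congr expR; ring.
have := ler_wpM2l (expR_ge0 (- v)) (expR_ge1Dx (v - u)); lra.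
Qed.

(** The second factors are exp z times exp (- u / s') with u = z s in [hi], and exp z times exp (- u
    / s) with u = z s' in [lo]. They tend to 1 as the band shrinks. *)
Let hi s s' := expR (- (phi * x s)) * expR (z * (1 - s / s')).
Let lo s s' := expR (- (phi * x s')) * expR (- (z * (s' / s - 1))).

(** On the band z L lies between z s and z s', so the kernel at u = z s bounds [Y] above and the one
    at u = z s' bounds it below. The resulting differences of tails are linearised by convexity of
    the exponential, then by the increments of [varphi]. *)
Let F_incr s s' : 0 < s -> s <= s' ->
  lo s s' * (x s' - x s) <= F s - F s' <= hi s s' * (x s' - x s).
Proof.
move=> s0 ss'; have s'0 : 0 < s' by exact: lt_le_trans ss'.
have u0 : 0 <= z * s by rewrite mulr_ge0// ltW.
have u'0 : 0 <= z * s' by rewrite mulr_ge0// ltW.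
have iY : P.-integrable (band s s') (EFin \o Y) by exact: bounded_integrable Y_bound.
have ik u : 0 <= u -> P.-integrable (band s s') (EFin \o k u).
  by move=> h; apply: (@bounded_integrable _ 1) => // w; exact: k01.
have ikM u : 0 <= u -> P.-integrable (band s s') (EFin \o (fun w => expR z * k u w)).
  move=> h; apply: (@bounded_integrable _ (expR z)) => //.
    exact: measurable_funM.
  move=> w; have /andP[h0 h1] := k01 w h.
  by rewrite mulr_ge0 ?expR_ge0//= ler_piMr ?expR_ge0.
rewrite /F (tl_band ss' mY Y_bound).
have band_k u : 0 <= u -> \int[P]_(w in band s s') (expR z * k u w) =
    expR z * (expR (- (a * (varphi beta (u / s) * s `^ del))) -
              expR (- (a * (varphi beta (u / s') * s' `^ del)))).
  move=> h; rewrite RintegralZl//; last exact: ik.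
  rewrite -(tl_band ss' (mk u) (fun w => k01 w h)) !tail_k//.
  by rewrite !mulNr.
apply/andP; split.
  apply: (@le_trans _ _ (\int[P]_(w in band s s') (expR z * k (z * s') w))); last first.
    apply: le_Rintegral => // [|w /= /andP[sw ws]]; first exact: ikM.
    rewrite Y_pos ?(lt_le_trans s0)// ler_wpM2l ?expR_ge0//.
    apply: laplace_kernel_anti => //; first by rewrite mulr_ge0.
    by rewrite ler_wpM2l// ltW.
  rewrite band_k//.
  have incr := varphi_increment_ge beta2 s0 ss' u'0.
  have d0' : 0 <= s' `^ del - s `^ del by rewrite subr_ge0 powR_del_le.
  have mono : varphi beta (z * s' / s) * s `^ del <= varphi beta (z * s' / s') * s' `^ del.
    by rewrite -subr_ge0; apply: le_trans incr; rewrite mulr_ge0// expR_ge0.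
  apply: (le_trans _ (ler_wpM2l (expR_ge0 z) (expB_ge (ler_wpM2l a0 mono)))).
  rewrite mulfK ?gt_eqF// -/phi in incr *.
  have -> : lo s s' * (x s' - x s) = expR z * (expR (- (phi * x s')) *
      (a * (expR (- (z * s' / s)) * (s' `^ del - s `^ del)))).
    have e1 : expR (- (z * (s' / s - 1))) = expR z * expR (- (z * s' / s)).
      by rewrite -expRD; congr expR; ring.
    by rewrite /lo e1 /x; ring.
  have -> : expR z * (expR (- (a * (phi * s' `^ del))) *
      (a * (phi * s' `^ del) - a * (varphi beta (z * s' / s) * s `^ del))) =
      expR z * (expR (- (phi * x s')) *
      (a * (phi * s' `^ del - varphi beta (z * s' / s) * s `^ del))).
    have e2 : a * (phi * s' `^ del) = phi * x s' by rewrite /x; ring.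
    by rewrite -e2; congr (_ * (_ * _)); ring.
  by rewrite !ler_wpM2l ?expR_ge0.
apply: (@le_trans _ _ (\int[P]_(w in band s s') (expR z * k (z * s) w))).
  apply: le_Rintegral => // [|w /= /andP[sw ws]]; first exact: ikM.
  rewrite Y_pos ?(lt_le_trans s0)// ler_wpM2l ?expR_ge0//.
  by apply: laplace_kernel_anti => //; rewrite ler_wpM2l.
rewrite band_k//.
have incr := varphi_increment_le beta2 s0 ss' u0.
have incr' := varphi_increment_ge beta2 s0 ss' u0.
have d0' : 0 <= s' `^ del - s `^ del by rewrite subr_ge0 powR_del_le.
have mono : varphi beta (z * s / s) * s `^ del <= varphi beta (z * s / s') * s' `^ del.
  by rewrite -subr_ge0; apply: le_trans incr'; rewrite mulr_ge0// expR_ge0.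
apply: (le_trans (ler_wpM2l (expR_ge0 z) (expB_le (ler_wpM2l a0 mono)))).
rewrite mulfK ?gt_eqF// -/phi in incr *.
have -> : hi s s' * (x s' - x s) = expR z * (expR (- (phi * x s)) *
    (a * (expR (- (z * s / s')) * (s' `^ del - s `^ del)))).
  have e1 : expR (z * (1 - s / s')) = expR z * expR (- (z * s / s')).
    by rewrite -expRD; congr expR; ring.
  by rewrite /hi e1 /x; ring.
have -> : expR z * (expR (- (a * (phi * s `^ del))) *
    (a * (varphi beta (z * s / s') * s' `^ del) - a * (phi * s `^ del))) =
    expR z * (expR (- (phi * x s)) *
    (a * (varphi beta (z * s / s') * s' `^ del - phi * s `^ del))).
  have e2 : a * (phi * s `^ del) = phi * x s by rewrite /x; ring.
  by rewrite -e2; congr (_ * (_ * _)); ring.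
by rewrite !ler_wpM2l ?expR_ge0.
Qed.

Let fine_P_band s s' : s <= s' ->
  fine (P (band s s')) = fine (P (tl s)) - fine (P (tl s')).
Proof.
move=> ss'.
have := @tl_band (cst 1) 1 s s' ss' (measurable_cst _).
by rewrite !Rintegral_cst// !mul1r => -> // w; rewrite ler01 lexx.
Qed.

Let g_anti s s' : 0 <= s -> s <= s' -> g s' <= g s.
Proof.
move=> s0 ss'; rewrite ler_expR !mulNr lerN2 ler_wpM2l//.
  by rewrite mulr_ge0// subr_ge0.
by apply: ge0_ler_powR; rewrite ?nnegrE ?(ltW del0)// (le_trans s0).
Qed.

Let gE s : g s * expR (- x s) = expR (- (phi * x s)).
Proof. by rewrite /g -expRD; congr expR; rewrite /x; ring. Qed.

(** [g] is decreasing and the probability of the band is a difference of exponentials; [gE] merges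
    the two exponents. The factors of [hi] and [lo] depending on [z] are mere slack here, being at
    least 1 and at most 1. *)
Let H_incr s s' : 0 < s -> s <= s' ->
  lo s s' * (x s' - x s) <= H s - H s' <= hi s s' * (x s' - x s).
Proof.
move=> s0 ss'; have s'0 : 0 < s' by exact: lt_le_trans ss'.
have xx' := x_le s0 ss'.
rewrite /H (tl_band ss' mgL gL01).
have igL : P.-integrable (band s s') (EFin \o (g \o L)) by exact: bounded_integrable gL01.
have icst c : P.-integrable (band s s') (EFin \o cst c) by exact: finite_measure_integrable_cst.
have Pb : fine (P (band s s')) = expR (- x s) - expR (- x s').
  by rewrite fine_P_band// !tail_P.
apply/andP; split.
  apply: (@le_trans _ _ (\int[P]_(w in band s s') g s')); last first.
    apply: le_Rintegral => // [|w /= /andP[sw ws]]; first exact: (icst (g s')).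
    apply: g_anti; last exact: ltW.
    exact: L0.
  rewrite Rintegral_cst// Pb.
  apply: (le_trans _ (ler_wpM2l (proj1 (andP (g01 s'))) (expB_ge xx'))).
  rewrite mulrA gE ler_wpM2r ?subr_ge0// /lo ler_piMr ?expR_ge0//.
  have h1 : 1 <= s' / s by rewrite ler_pdivlMr// mul1r.
  by rewrite -[leRHS]expR0 ler_expR oppr_le0 mulr_ge0// subr_ge0.
apply: (@le_trans _ _ (\int[P]_(w in band s s') g s)).
  apply: le_Rintegral => // [|w /= /andP[sw ws]]; first exact: (icst (g s)).
  by apply: g_anti => //; exact: ltW.
rewrite Rintegral_cst// Pb.
apply: (le_trans (ler_wpM2l (proj1 (andP (g01 s))) (expB_le xx'))).
rewrite mulrA gE ler_wpM2r ?subr_ge0// /hi ler_peMr ?expR_ge0//.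
have h1 : s / s' <= 1 by rewrite ler_pdivrMr// mul1r.
by rewrite -[leLHS]expR0 ler_expR mulr_ge0// subr_ge0.
Qed.

(** In the coordinate s = exp y the positive half-line becomes all of [R], on which [x] is
    differentiable everywhere. *)
Let x_exp y : x (expR y) = a * expR (del * y).
Proof. by rewrite /x /powR gt_eqF ?expR_gt0// expRK. Qed.

(** The band bounds presuppose ordered endpoints; adding the term with swapped arguments covers y'
    on either side of y. *)
Let eps y y' := `|hi (expR y) (expR y') - lo (expR y) (expR y')| +
  `|hi (expR y') (expR y) - lo (expR y') (expR y)|.

Let eps_cvg y : eps y y' @[y' --> y] --> (0 : R).
Proof.
have divE u v : expR u / expR v = expR (u - v) by rewrite expRB.
have sub1 : eps y = fun y' =>
  `|expR (- (phi * (a * expR (del * y)))) * expR (z * (1 - expR (y - y'))) -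
    expR (- (phi * (a * expR (del * y')))) * expR (- (z * (expR (y' - y) - 1)))| +
  `|expR (- (phi * (a * expR (del * y')))) * expR (z * (1 - expR (y' - y))) -
    expR (- (phi * (a * expR (del * y)))) * expR (- (z * (expR (y - y') - 1)))|.
  by apply/funext => y'; rewrite /eps /hi /lo !x_exp !divE.
have dcont (f : R -> R) : derivable f y 1 -> f y' @[y' --> y] --> f y.
  by move=> df; apply: differentiable_continuous; apply/derivable1_diffP.
have -> : 0 = eps y y.
  by rewrite sub1 !subrr expR0 subrr mulr0 oppr0 subrr normr0 addr0.
rewrite sub1; apply: cvgD; apply: cvg_norm; apply: dcont; exact: ex_derive.
Qed.

Let psi y := F (expR y) - H (expR y).

Let psi_incr y y' : `|psi y' - psi y| <= `|x (expR y') - x (expR y)| * eps y y'.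
Proof.
have main u v : u <= v -> `|psi v - psi u| <= `|x (expR v) - x (expR u)| *
    `|hi (expR u) (expR v) - lo (expR u) (expR v)|.
  move=> uv; have euv : expR u <= expR v by rewrite ler_expR.
  have /andP[f1 f2] := F_incr (expR_gt0 u) euv.
  have /andP[h1 h2] := H_incr (expR_gt0 u) euv.
  have xx' := x_le (expR_gt0 u) euv.
  rewrite -normrM [X in _ <= `|X|]mulrC mulrBl.
  apply: (@le_trans _ _ (hi (expR u) (expR v) * (x (expR v) - x (expR u)) -
    lo (expR u) (expR v) * (x (expR v) - x (expR u)))); last exact: ler_norm.
  exact: norm_sub_incr f1 f2 h1 h2.
have [yy'|y'y] := leP y y'.
  apply: (le_trans (main _ _ yy')); rewrite ler_wpM2l// lerDl; exact: normr_ge0.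
rewrite distrC [X in X * _]distrC.
by apply: (le_trans (main _ _ (ltW y'y))); rewrite ler_wpM2l// lerDr.
Qed.

Let le_tail s : `|F s - H s| <= (expR z + 1) * fine (P (tl s)).
Proof.
have iY : P.-integrable (tl s) (EFin \o Y) by exact: bounded_integrable Y_bound.
have igL : P.-integrable (tl s) (EFin \o (g \o L)) by exact: bounded_integrable gL01.
have icst c : P.-integrable (tl s) (EFin \o cst c) by exact: finite_measure_integrable_cst.
have F0 : 0 <= F s by apply: Rintegral_ge0 => w _; case/andP: (Y_bound w).
have H0 : 0 <= H s by apply: Rintegral_ge0 => w _; case/andP: (gL01 w).
have F1 : F s <= expR z * fine (P (tl s)).
  rewrite -Rintegral_cst//; apply: le_Rintegral => // [|w _].
    exact: (icst (expR z)).
  by case/andP: (Y_bound w).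
have H1 : H s <= 1 * fine (P (tl s)).
  rewrite -Rintegral_cst//; apply: le_Rintegral => // [|w _].
    exact: (icst 1).
  by case/andP: (gL01 w).
by rewrite mulrDl; exact: norm_sub_le.
Qed.

Let FH_pos s : 0 < s -> F s = H s.
Proof.
move=> s0; have psiE y : psi y = psi (ln s).
  apply: (@cst_of_small_increments _ psi (fun y => x (expR y)) eps) => // y1.
  rewrite (_ : (fun y => _) = fun y => a * expR (del * y)); first exact: ex_derive.
  by apply/funext => y2; rewrite x_exp.
apply/eqP; rewrite -subr_eq0 -normr_le0.
(* [psi] being constant, its value is computed at infinity, where both [F] and [H] are at most a
   multiple of the tail probability; [n.+1] keeps the arguments of [ln] positive. *)
have tl0 : fine (P (tl n.+1%:R)) @[n --> \oo] --> (0 : R).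
  have tlc : P (tl n.+1%:R) @[n --> \oo] --> (0 : \bar R)%E.
    rewrite -(@measure0 _ _ _ P) (_ : set0 = \bigcap_n tl n.+1%:R); last first.
      apply/seteqP; split => // w h.
      have := h (Num.bound (L w)) Logic.I; rewrite /tl/= leNgt => /negP; apply.
      by rewrite (lt_trans (archi_boundP (L0 w)))// ltr_nat.
    apply: (@nonincreasing_cvg_mu _ _ _ P (fun n => tl n.+1%:R)) => //.
    - by rewrite (le_lt_trans (probability_le1 _ _))// ltry.
    - by apply: bigcap_measurableType => n _.
    - apply/nonincreasing_seqP => n; rewrite subsetEset => w; rewrite /tl/=.
      by apply: le_trans; rewrite ler_nat.
  exact: (fine_cvg tlc).
have bnd : (expR z + 1) * fine (P (tl n.+1%:R)) @[n --> \oo] --> (0 : R).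
  by rewrite -[X in _ --> X](mulr0 (expR z + 1)); apply: cvgM; [exact: cvg_cst|].
rewrite -(cvg_lim _ bnd)//; apply: limr_ge; first exact: cvgP bnd.
apply: nearW => n.
have <- : psi (ln n.+1%:R) = F s - H s by rewrite psiE /psi lnK ?posrE.
by rewrite /psi lnK ?posrE//; exact: le_tail.
Qed.

(** For [s <= 0] both sides are full expectations. They differ from the values at a small t > 0 only
    over L < t, an event of probability at most [x t], which also excludes an atom of [L] at 0. *)
Let FH s : F s = H s.
Proof.
have [s0|s0] := ltP 0 s; first exact: FH_pos.
have tlT t : t <= 0 -> tl t = setT.
  by move=> t0; apply/seteqP; split => // w _; rewrite /tl/=; exact: le_trans (L0 w).
have -> : F s = F 0 by rewrite /F !tlT.
have -> : H s = H 0 by rewrite /H !tlT.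
apply/eqP; rewrite -subr_eq0 -normr_le0.
apply/ler_addgt0Pl => e e0; rewrite addr0.
have ez0 : 0 < expR z + 1 by rewrite addr_gt0// expR_gt0.
have [t t0 te] : exists2 t, 0 < t & (expR z + 1) * x t <= e.
  (* The witness solves (exp z + 1) (a + 1) t^(2/beta) = e; using a + 1 instead of a keeps the
     divisor positive when a = 0. *)
  have c0 : 0 < (expR z + 1) * (a + 1) by rewrite mulr_gt0// ltr_wpDl.
  exists ((e / ((expR z + 1) * (a + 1))) `^ del^-1).
    by rewrite powR_gt0// divr_gt0.
  rewrite /x -powRrM mulVf ?gt_eqF// powRr1; last by rewrite divr_ge0// ltW.
  rewrite mulrA mulrA ler_pdivrMr// mulrC ler_wpM2l ?(ltW e0)//.
  by rewrite ler_wpM2l ?(ltW ez0)// lerDl.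
have P0t : fine (P (band 0 t)) <= x t.
  rewrite fine_P_band ?(ltW t0)// (tail_P t0).
  have P1 : fine (P (tl 0)) <= 1.
    by rewrite -lee_fin fineK ?fin_num_measure// probability_le1.
  apply: (le_trans (lerB P1 (expR_ge1Dx (- x t)))).
  by rewrite opprD opprK addrA subrr add0r.
have iY : P.-integrable (band 0 t) (EFin \o Y) by exact: bounded_integrable Y_bound.
have igL : P.-integrable (band 0 t) (EFin \o (g \o L)) by exact: bounded_integrable gL01.
have icst c : P.-integrable (band 0 t) (EFin \o cst c) by exact: finite_measure_integrable_cst.
have FE := tl_band (ltW t0) mY Y_bound.
have HE := tl_band (ltW t0) mgL gL01.
have -> : F 0 - H 0 = \int[P]_(w in band 0 t) Y w - \int[P]_(w in band 0 t) g (L w).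
  by rewrite -FE -HE -/(F 0) -/(F t) -/(H 0) -/(H t) (FH_pos t0); ring.
apply: (le_trans _ te); apply: (@le_trans _ _ ((expR z + 1) * fine (P (band 0 t)))).
  rewrite mulrDl; apply: norm_sub_le.
  - by apply: Rintegral_ge0 => w _; case/andP: (Y_bound w).
  - rewrite -Rintegral_cst//; apply: le_Rintegral => // [|w _].
      exact: (icst (expR z)).
    by case/andP: (Y_bound w).
  - by apply: Rintegral_ge0 => w _; case/andP: (gL01 w).
  - rewrite -Rintegral_cst//; apply: le_Rintegral => // [|w _].
      exact: (icst 1).
    by case/andP: (gL01 w).
by rewrite ler_wpM2l ?(ltW ez0).
Qed.

(** The exponent may be -oo but never +oo, so [fine] loses nothing. *)
Let YE w : expeR (- (z%:E * ((L w)%:E * I w - 1)))%E = (Y w)%:E.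
Proof.
rewrite /Y fineK//.
case: (I w) (I0 w) => [r| |]//= _.
have := L0 w; rewrite le_eqVlt => /predU1P[Lw|Lw].
  by rewrite -Lw mul0e add0e.
rewrite gt0_muley ?lte_fin//=.
move: z0; rewrite le_eqVlt => /predU1P[<-|zpos]; first by rewrite mul0e.
by rewrite gt0_muley ?lte_fin.
Qed.

(** As functions of [B], both sides are finite measures, the laws of [L] weighted by [Y] and by
    [g \o L]; the equality of [F] and [H] is their agreement on closed half-lines. *)
Lemma conditional_laplace_integral (B : set R) : measurable B ->
  (\int[P]_(w in L @^-1` B) expeR (- (z%:E * ((L w)%:E * I w - 1))) =
   \int[pushforward P L]_(s in B) (expR (- a * (varphi beta z - 1) * s `^ del))%:E)%E.
Proof.
move=> mB.
rewrite (ge0_integral_pushforward mL P mB); first last.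
- by move=> s _; rewrite lee_fin expR_ge0.
- by apply/measurable_EFinP; exact: measurable_funTS.
transitivity (\int[P]_(w in L @^-1` B) (Y w)%:E)%E.
  by apply: eq_integral => w _; exact: YE.
pose nu1 := weighted_law P mL mY Y_bound.
pose nu2 := weighted_law P mL mgL gL01.
suff : nu1 B = nu2 B by [].
have mR : measurable = <<s @RGenCInfty.G R >> by exact: RGenCInfty.measurableE.
apply: (@measure_unique _ _ _ (@RGenCInfty.G R) (fun n => `[(- n%:R)%R, +oo[%classic)) => //.
- move=> _ _ [u ->] [v ->]; exists (Num.max u v).
  by apply/seteqP; split => t /=; rewrite !in_itv/= !andbT ge_max => /andP.
- by move=> n; exists (- n%:R).
- apply/seteqP; split => // t _; exists (Num.bound `|t|) => //=.
  rewrite in_itv/= andbT lerNl; apply: (le_trans (ler_norm _)); rewrite normrN.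
  by apply/ltW/archi_boundP.
- move=> _ [u ->].
  have tlE : L @^-1` `[u, +oo[%classic = tl u.
    by apply/seteqP; split => w /=; rewrite in_itv/= andbT.
  have iY : P.-integrable (tl u) (EFin \o Y) by exact: bounded_integrable Y_bound.
  have igL : P.-integrable (tl u) (EFin \o (g \o L)) by exact: bounded_integrable gL01.
  have nu1E : nu1 `[u, +oo[%classic = (F u)%:E.
    by rewrite /nu1 /weighted_law tlE /F /Rintegral fineK// integrable_fin_num.
  have nu2E : nu2 `[u, +oo[%classic = (H u)%:E.
    by rewrite /nu2 /weighted_law tlE /H /Rintegral fineK// integrable_fin_num.
  by apply: (etrans nu1E); rewrite FH; exact: esym nu2E.
- move=> n; have := weighted_law_fin P mL mY Y_bound (measurable_itv `[(- n%:R)%R, +oo[).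
  by rewrite ge0_fin_numE//; exact: measure_ge0.
Qed.

End conditional_laplace.

Theorem proposition7 (R : realType) (d : measure_display)
    (T : measurableType d) (P : probability T R)
    (lambda K beta : R) (X : nat -> {RV P >-> (R * R)%type})
    (Ss : nat -> {RV P >-> R}) (S : {RV P >-> R}) :
  0 < lambda -> 0 < K -> 2 < beta ->
  homogeneous_poisson_process P lambda X ->
  (forall w, 0 < S w) ->
  (forall i w, 0 < Ss i w) ->
  (forall i (B : set R), measurable B ->
     distribution P (Ss i) B = distribution P S B) ->
  mutually_independent P Ss ->
  independent_families P X Ss ->
  ('E_P[fun w => (S w `^ (2 / beta))%R] < +oo)%E ->
  let L := path_loss_factor K beta X Ss in
  let f := interference_factor K beta X Ss in
  let a := lambda * pi * fine 'E_P[fun w => (S w `^ (2 / beta))%R] / K ^+ 2 in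
  forall z : R, 0 <= z ->
  let Y := fun w => expeR (- (z%:E * f w))%E in
  (exists g : R -> \bar R, is_cond_expectation P L Y g) /\
  (forall g : R -> \bar R, is_cond_expectation P L Y g ->
     \forall s \ae pushforward P L, 0 < s ->
       g s = (expR (- a * (varphi beta z - 1) * s `^ (2 / beta)))%:E).
Proof.
move=> lambda0 K0 beta2 poissonX S0 Ss0 lawS indS indXS finS L f a z z0 Y.
have mL : measurable_fun setT L by exact: (measurable_path_loss_factor K beta X Ss0).
have L0 w : 0 <= L w by exact: path_loss_factor_ge0.
have a0 : 0 <= a.
  rewrite /a divr_ge0 ?sqr_ge0// mulr_ge0 ?mulr_ge0 ?(ltW lambda0) ?pi_ge0//.
  apply: fine_ge0; rewrite unlock; apply: integral_ge0 => w _.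
  by rewrite lee_fin powR_ge0.
have intE := @conditional_laplace_integral _ T R P L
  (inverse_loss_sum K beta X Ss) a beta mL L0 (measurable_inverse_loss_sum K beta X Ss0)
  (inverse_loss_sum_ge0 K beta X Ss0) a0 beta2
  (fun s z => @laplace_tail R d T P lambda K beta X Ss S lambda0 K0 beta2
     poissonX S0 Ss0 lawS indS indXS finS s z) z z0.
pose g s := (expR (- a * (varphi beta z - 1) * s `^ (2 / beta)))%:E.
(* Bundling [L] as a random variable gives its pushforward the structure of a probability
   measure. *)
pose Lm : {RV P >-> R} := HB.pack L (isMeasurableFun.Build _ _ _ _ L mL).
have mg : measurable_fun setT g.
  apply/measurable_EFinP; apply: (measurableT_comp (@measurable_expR R)).
  by apply: measurable_funM => //; exact: measurable_powR.
have g01 s : (0 <= g s <= 1)%E.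
  have h : 0 <= a * (varphi beta z - 1) * s `^ (2 / beta).
    by rewrite mulr_ge0 ?powR_ge0// mulr_ge0// subr_ge0 varphi_ge1.
  by rewrite !lee_fin expR_ge0/= -[leRHS]expR0 ler_expR !mulNr oppr_le0.
have ig : (distribution P Lm).-integrable setT g.
  apply: (@le_integrable _ _ _ _ setT measurableT g (EFin \o cst 1)) => //.
    move=> s _ /=; rewrite lee_fin normr1 ger0_norm ?expR_ge0// -lee_fin.
    by case/andP: (g01 s).
  exact: finite_measure_integrable_cst.
split.
  by exists g; split => // B mB; exact: intE.
move=> g' [ig' intE'].
(* Integrals over all measurable sets determine an integrable function up to a null set of the law
   of [L]. *)
have : ae_eq (distribution P Lm) setT g' g.
  apply: integral_ae_eq => // E _ mE.
  by rewrite -[LHS](intE' E mE); exact: intE.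
by apply: filterS => s gs _; exact: gs.
Qed.
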